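(* Assume that $T$ is a bi-parameter flag SIO in $\mathbb R^d=\mathbb R^{d_1}\times\mathbb R^{d_2}$ satisfying the cube testing condition $$\|1_QT1_Q\|_{L^2}\lesssim|Q|^{1/2}$$ for all cubes $Q\subset\mathbb R^d$. Then $$\sup_{Q\in\mathcal D_=}|Q|^{-1/2}\Big(\sum_{\substack{I\in\mathcal D_= \\ {I\subset Q}}}|\langle T1,h^0_{I^1}\otimes h_{I^2}\rangle|^2\Big)^{1/2}<\infty.$$
   Context: $\mathcal D=\mathcal D^1\times\mathcal D^2$ with $\mathcal D^m$ a dyadic grid in $\mathbb R^{d_m}$, and $\mathcal D_==\{I=I^1\times I^2\in\mathcal D:\ell(I^1)=\ell(I^2)\}$ (dyadic cubes of $\mathbb R^d$). For an interval, $h^0_I=|I|^{-1/2}1_I$, $h^1_I=|I|^{-1/2}(1_{I_l}-1_{I_r})$ (left/right halves); for a cube $I=I_1\times\dots\times I_m$ and $\eta\in\{0,1\}^m$, $h_I^\eta=\bigotimes h_{I_i}^{\eta_i}$. $h_I$ denotes a cancellative Haar function $h_I^\eta$, $\eta\ne0$ (the finite sum over $\eta$ is suppressed), and $h_I^0$ the non-cancellative one. An $L^\infty$ atom on a cube $Q$ is $a_Q=1_Qa_Q$ with $\int a_Q=0$, $\|a_Q\|_\infty\le1$. **Kernel convention.** Let $F(x,y)$ be a function depending on the variables of a set $P$ of parameters and $S(x,y)\ge0$. ''F is an $S$-kernel in $P$'' means: for every $A\subset P$ (including $A=\emptyset$), all admissible $x,y$ and all $x_i'$, $i\in A$, with $|x_i'-x_i|\le|x_i-y_i|/2$,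 $$\Big|\sum_{B\subset A}(-1)^{|A\setminus B|}F(x^B,y)\Big|\le C_K\prod_{i\in A}\Big(\frac{|x_i'-x_i|}{|x_i-y_i|}\Big)^{\alpha_i}S(x,y),$$ where $x^B$ is $x$ with $x_i$ replaced by $x_i'$ for $i\in B$ ($0/0=0$), and the same estimates hold for every kernel obtained from $F$ by interchanging $x_i$ and $y_i$ for $i$ in an arbitrary subset of $P$. Here $\alpha_i\in(0,1]$ and $C_K$ are fixed. ''Disjoint supports in parameter $i$'' for $f,g$ means that the projections of their supports to $\mathbb R^{d_i}$ are disjoint. **Bi-parameter flag SIO.** A linear operator $T$, with bilinear form $\langle Tf,g\rangle$ a priori defined at least for indicators of rectangles (and the functions used below), such that: (i) There is $K$ defined where $x_1\ne y_1$ with $\langle Tf,g\rangle=\iint K(x,y)f(y)g(x)\,dy\,dx$ when $f,g$ have disjoint supports in parameters 1 and 2; $K$ is a $\mathrm{size}_F$-kernel in $\{1,2\}$, $\mathrm{size}_F(x,y)=|x_1-y_1|^{-d_1}(|x_1-y_1|+|x_2-y_2|)^{-d_2}$. (ii) For every cube $I^1\subset\mathbb R^{d_1}$ and $(u,v)$ equal to $(1_{I^1},1_{I^1})$, $(a_{I^1},1_{I^1})$ or $(1_{I^1},a_{I^1})$ with $a_{I^1}$ an $L^\infty$ atom, there is a kernel $K_{I^1}(x_2,y_2)$, $x_2\ne y_2$, with $\langle T(u\otimes f_2),v\otimes g_2\rangle=\iint K_{I^1}(x_2,y_2)f_2(y_2)g_2(x_2)\,dy_2dx_2$ if $\operatorname{supp}f_2\cap\operatorname{supp}g_2=\emptyset$;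 it is an $S$-kernel in $\{2\}$ with $S=|I^1||x_2-y_2|^{-d_2}$. (iii) For every cube $I^2\subset\mathbb R^{d_2}$ and $(u,v)$ equal to $(1_{I^2},1_{I^2})$, $(a_{I^2},1_{I^2})$ or $(1_{I^2},a_{I^2})$, there is a kernel $K_{I^2}(x_1,y_1)$, $x_1\ne y_1$, with $\langle T(f_1\otimes u),g_1\otimes v\rangle=\iint K_{I^2}(x_1,y_1)f_1(y_1)g_1(x_1)\,dy_1dx_1$ if $\operatorname{supp}f_1\cap\operatorname{supp}g_1=\emptyset$; it is an $S$-kernel in $\{1\}$ with $S=|I^2|^2|x_1-y_1|^{-d_1}(|x_1-y_1|+\ell(I^2))^{-d_2}$. **The pairing with $T1$.** For $I\subset Q$, $I,Q\in\mathcal D_=$, $Q=Q^1\times Q^2$, $\langle T1,h^0_{I^1}\otimes h_{I^2}\rangle$ is defined by splitting $1=1_{3Q}+1_{(3Q^1)^c\times3Q^2}+1_{3Q^1\times(3Q^2)^c}+1_{(3Q^1)^c\times(3Q^2)^c}$; the local term uses the a priori defined form, and the non-local terms are defined by the full and partial kernel representations (after splitting the cubes into subcubes as needed and using $\int h_{I^2}=0$), which yield absolutely convergent integrals. *)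

(* Defs.v *)
From HB Require Import structures.
From mathcomp Require Import all_boot all_order all_algebra.
From mathcomp Require Import all_classical all_reals all_analysis.

Set Implicit Arguments.
Unset Strict Implicit.
Unset Printing Implicit Defensive.

Import Order.TTheory GRing.Theory Num.Theory.
Import numFieldNormedType.Exports.

Local Open Scope classical_set_scope.
Local Open Scope ring_scope.

Notation Rn R n := (n.-tuple (measurableTypeR R)).

(* The library's sigma-finiteness instance for [m1 \x m2] is shadowed by the one
   for subprobabilities, so it is not found by inference; recover it here. *)
Lemma sigma_finite_prod d1 d2 (T1 : measurableType d1) (T2 : measurableType d2)
    (R : realType) (m1 : {sigma_finite_measure set T1 -> \bar R})
    (m2 : {sigma_finite_measure set T2 -> \bar R}) :
  sigma_finite [set: (T1 * T2)%type] (m1 \x m2)%E.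
Proof.
by case: (lebesgue_integral_fubini.measure_function_Measure_isSigmaFinite__to__measure_function_isSigmaFinite m1 m2).
Qed.

Section lebesgue_Rn.
Context (R : realType).
Local Notation R1 := (measurableTypeR R).

Definition Rn_cons n (z : R1 * Rn R n) : Rn R n.+1 := [tuple of z.1 :: z.2].
Definition Rn_uncons n (x : Rn R n.+1) : R1 * Rn R n :=
  (thead x, [tuple of behead x]).

Lemma Rn_consK n : cancel (@Rn_cons n) (@Rn_uncons n).
Proof.
by case=> a t; rewrite /Rn_cons /Rn_uncons /=; congr pair; exact: val_inj.
Qed.

Lemma Rn_unconsK n : cancel (@Rn_uncons n) (@Rn_cons n).
Proof. by move=> x; rewrite [RHS]tuple_eta; exact: val_inj. Qed.

Lemma measurable_Rn_cons n : measurable_fun [set: R1 * Rn R n] (@Rn_cons n).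
Proof.
apply: (@measurable_cons _ _ (R1 * Rn R n)%type R1 fst n snd).
- exact: measurable_fst.
- exact: measurable_snd.
Qed.

Lemma measurable_Rn_uncons n : measurable_fun [set: Rn R n.+1] (@Rn_uncons n).
Proof.
apply/measurable_fun_pair; first exact: measurable_tnth.
exact: measurable_behead.
Qed.

Section step.
Context n (mu : {sigma_finite_measure set (Rn R n) -> \bar R}).

Definition leb_step : set (Rn R n.+1) -> \bar R :=
  pushforward ((@lebesgue_measure R) \x mu)%E (@Rn_cons n).

Let mcons A : measurable A -> measurable (@Rn_cons n @^-1` A).
Proof.
by move=> mA; rewrite -[X in measurable X]setTI; exact: measurable_Rn_cons.
Qed.

Let step0 : leb_step set0 = 0%E.
Proof. by rewrite /leb_step /pushforward preimage_set0 measure0. Qed.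

Let step_ge0 A : (0 <= leb_step A)%E.
Proof. by rewrite /leb_step /pushforward; exact: measure_ge0. Qed.

Let step_sigma_additive : semi_sigma_additive leb_step.
Proof.
move=> F mF tF mUF; rewrite /leb_step /pushforward preimage_bigcup.
apply: measure_semi_sigma_additive.
- by move=> k; exact: mcons.
- apply/trivIsetP => /= i j _ _ ij; rewrite -preimage_setI.
  by move/trivIsetP : tF => /(_ _ _ _ _ ij) ->//; rewrite preimage_set0.
- by rewrite -preimage_bigcup; exact: mcons.
Qed.

HB.instance Definition _ :=
  isMeasure.Build _ _ _ leb_step step0 step_ge0 step_sigma_additive.

Let step_sigma_finite : sigma_finite setT leb_step.
Proof.
have [F FT Ffin] := sigma_finite_prod (@lebesgue_measure R) mu.
exists (fun k => @Rn_uncons n @^-1` (F k)).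
  by rewrite -preimage_bigcup -FT preimage_setT.
move=> k; have [mF Fk] := Ffin k; split.
  by rewrite -[X in measurable X]setTI; exact: measurable_Rn_uncons.
rewrite /leb_step /pushforward -comp_preimage.
by rewrite (_ : _ \o _ = id)//; apply/funext => z /=; rewrite Rn_consK.
Qed.

HB.instance Definition _ :=
  Measure_isSigmaFinite.Build _ _ _ leb_step step_sigma_finite.

End step.

(* Lebesgue measure on R^n; R^0 carries the unit mass. *)
Fixpoint leb n : {sigma_finite_measure set (Rn R n) -> \bar R} :=
  match n with
  | 0 => \d_([tuple] : Rn R 0)
  | m.+1 => leb_step (leb m)
  end.

Definition leb2 d1 d2 : set (Rn R d1 * Rn R d2) -> \bar R :=
  (leb d1 \x leb d2)%E.

HB.instance Definition _ d1 d2 := Measure.on (@leb2 d1 d2).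
HB.instance Definition _ d1 d2 := Measure_isSigmaFinite.Build _ _ _
  (@leb2 d1 d2) (sigma_finite_prod (leb d1) (leb d2)).

End lebesgue_Rn.
Arguments leb : clear implicits.
Arguments leb2 : clear implicits.


Section geometry.
Context (R : realType) (n : nat).
Implicit Types x y : Rn R n.

Definition edist x y : R :=
  Num.sqrt (\sum_(i < n) (tnth x i - tnth y i) ^+ 2).

(* A cube is given by its lower-left corner and its side length; as a point set
   it is half-open. *)
Definition cube : Type := (Rn R n * {posnum R})%type.
HB.instance Definition _ := Choice.on cube.

Implicit Types I J : cube.

Definition side I : R := I.2%:num.

Definition cset I : set (Rn R n) :=
  [set x | forall i, tnth I.1 i <= tnth x i < tnth I.1 i + side I].

Definition vol I : R := side I ^+ n.

Definition center I : Rn R n := [tuple tnth I.1 i + side I / 2 | i < n].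

Definition triple I : cube :=
  ([tuple tnth I.1 i - side I | i < n], (3 * I.2%:num)%:pos).

Definition ind I : Rn R n -> R := \1_(cset I).

Definition haar1 (a l : R) (e : bool) (t : R) : R :=
  (Num.sqrt l)^-1 *
  (if e then \1_(`[a, a + l / 2[%classic : set R) t
             - \1_(`[a + l / 2, a + l[%classic : set R) t
   else \1_(`[a, a + l[%classic : set R) t).

Definition haar I (eta : {ffun 'I_n -> bool}) : Rn R n -> R :=
  fun x => \prod_(i < n) haar1 (tnth I.1 i) (side I) (eta i) (tnth x i).

Definition eta0 : {ffun 'I_n -> bool} := [ffun=> false].

(* A dyadic grid in general position: for every integer k the cubes of side 2^k
   partition R^n, and the grid is nested. *)
Definition dyadic_grid (D : set cube) : Prop :=
  [/\ forall I, D I -> exists k : int, side I = 2 ^ k,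
      forall (k : int) x, exists I, [/\ D I, side I = 2 ^ k & cset I x] &
      forall I J, D I -> D J ->
        [\/ cset I `<=` cset J, cset J `<=` cset I | cset I `&` cset J = set0]].

Definition atom I (a : Rn R n -> R) : Prop :=
  [/\ measurable_fun setT a,
      forall x, ~ cset I x -> a x = 0,
      (\int[leb R n]_x (a x)%:E = 0)%E &
      ('N[leb R n]_+oo[EFin \o a] <= 1)%E].

(* The pairs (1_I, 1_I), (a_I, 1_I), (1_I, a_I). *)
Definition test_pair I (u v : Rn R n -> R) : Prop :=
  [\/ u = ind I /\ v = ind I, atom I u /\ v = ind I | u = ind I /\ atom I v].

Definition supp (f : Rn R n -> R) : set (Rn R n) :=
  [set x | forall e : R, 0 < e -> exists y, edist x y < e /\ f y != 0].

Definition Linfc (f : Rn R n -> R) : Prop :=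
  [/\ measurable_fun setT f,
      ('N[leb R n]_+oo[EFin \o f] < +oo)%E &
      exists I, forall x, ~ cset I x -> f x = 0].

End geometry.
Arguments eta0 {n}.

Section cube_volume.
Context (R : realType).

Lemma cset_cons n (I : cube R n.+1) :
  @Rn_cons R n @^-1` cset I =
  `[thead I.1, thead I.1 + side I[%classic `*`
  cset (([tuple of behead I.1], I.2) : cube R n).
Proof.
have tl (x : Rn R n.+1) i : tnth [tuple of behead x] i = tnth x (lift ord0 i).
  by rewrite [in RHS](tuple_eta x) tnthS.
apply/seteqP; split=> -[a t] /=.
- move=> H; split; first by have := H ord0; rewrite in_itv.
  by move=> i; have := H (lift ord0 i); rewrite tl /= /Rn_cons tnthS.
- rewrite in_itv => -[/= H0 H] i; have [j ->|->] := unliftP ord0 i; last exact: H0.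
  by have := H j; rewrite tl /Rn_cons tnthS.
Qed.

Lemma measurable_cset n (I : cube R n) : measurable (cset I).
Proof.
rewrite (_ : cset I = \bigcap_(i in [set: 'I_n])
    ((@tnth n R)^~ i @^-1` `[tnth I.1 i, tnth I.1 i + side I[%classic)); last first.
  apply/seteqP; split=> x /= H i; first by move=> _ /=; rewrite in_itv /= H.
  by have := H i Logic.I; rewrite /= in_itv.
apply: fin_bigcap_measurable => [|i _]; first exact: finite_finset.
rewrite -[X in measurable X]setTI.
exact: (@measurable_tnth _ (measurableTypeR R) n i measurableT _ (measurable_itv _)).
Qed.

Lemma leb_cset n (I : cube R n) : leb R n (cset I) = (vol I)%:E.
Proof.
elim: n I => [|n IHn] I.
  rewrite /= /vol expr0 diracE mem_set//; by case.
rewrite [LHS]/= /leb_step /pushforward cset_cons product_measure1E//; last first.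
  exact: measurable_cset.
rewrite [X in (_ * X)%E]IHn [X in (X * _)%E]lebesgue_measure_itv /= lte_fin.
have sI : 0 < side I by rewrite /side.
rewrite ltrDl sI -EFinB addrAC subrr add0r -EFinM /vol exprS //.
Qed.

End cube_volume.

Section product.
Context (R : realType) (d1 d2 : nat).
Local Notation Rd := (Rn R d1 * Rn R d2)%type.

Definition tensor (f : Rn R d1 -> R) (g : Rn R d2 -> R) : Rd -> R :=
  fun x => f x.1 * g x.2.

Definition rect : Type := (cube R d1 * cube R d2)%type.
HB.instance Definition _ := Choice.on rect.

Definition rset (I : rect) : set Rd := cset I.1 `*` cset I.2.
Definition rvol (I : rect) : R := vol I.1 * vol I.2.
Definition rind (I : rect) : Rd -> R := tensor (ind I.1) (ind I.2).
Definition is_cube (I : rect) : Prop := side I.1 = side I.2.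

Definition supp2 (f : Rd -> R) : set Rd :=
  [set x | forall e : R, 0 < e ->
     exists y, [/\ edist x.1 y.1 < e, edist x.2 y.2 < e & f y != 0]].

Definition Linfc2 (f : Rd -> R) : Prop :=
  [/\ measurable_fun setT f,
      ('N[leb2 R d1 d2]_+oo[EFin \o f] < +oo)%E &
      exists I : rect, forall x, ~ rset I x -> f x = 0].

(* The cubes of the product grid D^1 x D^2 with equal side lengths. *)
Definition diag_grid (D1 : set (cube R d1)) (D2 : set (cube R d2)) : set rect :=
  [set I | [/\ D1 I.1, D2 I.2 & is_cube I]].

End product.

Definition kform (d : measure_display) (T : measurableType d) (R : realType)
    (mu : {sigma_finite_measure set T -> \bar R})
    (F : T -> T -> R) (f g : T -> R) : \bar R :=
  (\int[mu \x mu]_z (F z.1 z.2 * f z.2 * g z.1)%:E)%E.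

Section kernels.
Context (R : realType) (P : finType) (dim : P -> nat).
Local Notation pt := (forall i : P, Rn R (dim i)).

Definition mix (B : {set P}) (x x' : pt) : pt :=
  fun i => if i \in B then x' i else x i.

Definition kernel_estimate (alpha : P -> R) (CK : R) (adm : pt -> pt -> Prop)
    (S F : pt -> pt -> R) : Prop :=
  forall (A : {set P}) (x y x' : pt), adm x y ->
    (forall i, i \in A -> edist (x' i) (x i) <= edist (x i) (y i) / 2) ->
    `|\sum_(B in powerset A) (-1) ^+ #|A :\: B| * F (mix B x x') y|
      <= CK * \prod_(i in A) ((edist (x' i) (x i) / edist (x i) (y i))
                                `^ alpha i) * S x y.

(* The estimate for F and all kernels obtained from F by interchanging x_i and
   y_i for i in a set s. *)
Definition is_kernel (alpha : P -> R) (CK : R) (adm : pt -> pt -> Prop)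
    (S F : pt -> pt -> R) : Prop :=
  forall s : {set P}, kernel_estimate alpha CK adm S
    (fun x y => F (mix s x y) (mix s y x)).

End kernels.

Section flag.
Context (R : realType) (d1 d2 : nat).
Local Notation Rd := (Rn R d1 * Rn R d2)%type.

(* The parameter set {1, 2} is bool, with false for 1 and true for 2. *)
Definition dim2 (i : bool) : nat := if i then d2 else d1.

Definition sizeF (x y : Rd) : R :=
  (edist x.1 y.1 ^+ d1)^-1 * ((edist x.1 y.1 + edist x.2 y.2) ^+ d2)^-1.

Definition is_full_kernel (alpha1 alpha2 CK : R) (F : Rd -> Rd -> R) : Prop :=
  @is_kernel R bool dim2 (fun i => if i then alpha2 else alpha1) CK
    (fun x y => x false <> y false)
    (fun x y => sizeF (x false, x true) (y false, y true))
    (fun x y => F (x false, x true) (y false, y true)).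

Definition is_partial_kernel (n : nat) (alpha CK : R)
    (S F : Rn R n -> Rn R n -> R) : Prop :=
  @is_kernel R unit (fun=> n) (fun=> alpha) CK
    (fun x y => x tt <> y tt)
    (fun x y => S (x tt) (y tt))
    (fun x y => F (x tt) (y tt)).

(* A bi-parameter flag SIO, given by its bilinear form <Tf, g>. The form is
   meaningful on a linear space [dom] of bounded, boundedly supported functions,
   of which only a minimal content is prescribed. [kpar1 I1 u v] and
   [kpar2 I2 u v] are the partial kernels attached to the pair (u, v). *)
Record flagSIO : Type := FlagSIO {
  form : (Rd -> R) -> (Rd -> R) -> R;
  dom : set (Rd -> R);
  kfull : Rd -> Rd -> R;
  kpar1 : cube R d1 -> (Rn R d1 -> R) -> (Rn R d1 -> R) ->
          Rn R d2 -> Rn R d2 -> R;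
  kpar2 : cube R d2 -> (Rn R d2 -> R) -> (Rn R d2 -> R) ->
          Rn R d1 -> Rn R d1 -> R;
  alpha1 : R;
  alpha2 : R;
  CK : R;

  alpha1_itv : 0 < alpha1 <= 1;
  alpha2_itv : 0 < alpha2 <= 1;

  dom_Linfc : forall f, dom f -> Linfc2 f;
  dom_linear : forall (c : R) f g, dom f -> dom g -> dom (fun x => c * f x + g x);
  dom_rect : forall I : rect R d1 d2, dom (rind I);
  dom_atom1 : forall I1 I2 a, atom I1 a -> dom (tensor a (@ind R d2 I2));
  dom_atom2 : forall I1 I2 a, atom I2 a -> dom (tensor (@ind R d1 I1) a);

  form_linear_l : forall (c : R) f f' g, dom f -> dom f' -> dom g ->
    form (fun x => c * f x + f' x) g = c * form f g + form f' g;
  form_linear_r : forall (c : R) f g g', dom f -> dom g -> dom g' ->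
    form f (fun x => c * g x + g' x) = c * form f g + form f g';

  kfull_measurable : measurable_fun [set z : Rd * Rd | z.1.1 <> z.2.1]
    (fun z => kfull z.1 z.2);
  kfull_kernel : is_full_kernel alpha1 alpha2 CK kfull;
  kfull_repr : forall f g, dom f -> dom g ->
    fst @` supp2 f `&` fst @` supp2 g = set0 ->
    snd @` supp2 f `&` snd @` supp2 g = set0 ->
    (form f g)%:E = kform (leb2 R d1 d2) kfull f g;

  kpar1_measurable : forall I1 u v, test_pair I1 u v ->
    measurable_fun [set z : Rn R d2 * Rn R d2 | z.1 <> z.2]
      (fun z => kpar1 I1 u v z.1 z.2);
  kpar1_kernel : forall I1 u v, test_pair I1 u v ->
    is_partial_kernel alpha2 CK
      (fun x y => vol I1 * (edist x y ^+ d2)^-1) (kpar1 I1 u v);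
  kpar1_repr : forall I1 u v f g, test_pair I1 u v -> Linfc f -> Linfc g ->
    dom (tensor u f) -> dom (tensor v g) -> supp f `&` supp g = set0 ->
    (form (tensor u f) (tensor v g))%:E = kform (leb R d2) (kpar1 I1 u v) f g;

  kpar2_measurable : forall I2 u v, test_pair I2 u v ->
    measurable_fun [set z : Rn R d1 * Rn R d1 | z.1 <> z.2]
      (fun z => kpar2 I2 u v z.1 z.2);
  kpar2_kernel : forall I2 u v, test_pair I2 u v ->
    is_partial_kernel alpha1 CK
      (fun x y => vol I2 ^+ 2 * (edist x y ^+ d1)^-1
                  * ((edist x y + side I2) ^+ d2)^-1) (kpar2 I2 u v);
  kpar2_repr : forall I2 u v f g, test_pair I2 u v -> Linfc f -> Linfc g ->
    dom (tensor f u) -> dom (tensor g v) -> supp f `&` supp g = set0 ->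
    (form (tensor f u) (tensor g v))%:E = kform (leb R d1) (kpar2 I2 u v) f g
}.

(* [phi] is the function 1_Q T1_Q. *)
Definition cube_testing (T : flagSIO) : Prop :=
  exists C : R, forall Q : rect R d1 d2, is_cube Q ->
    exists phi : Rd -> R,
      [/\ measurable_fun setT phi,
          forall x, ~ rset Q x -> phi x = 0,
          forall g, dom T g -> (forall x, ~ rset Q x -> g x = 0) ->
            (form T (rind Q) g)%:E = (\int[leb2 R d1 d2]_x (phi x * g x)%:E)%E &
          ('N[leb2 R d1 d2]_2[EFin \o phi] <= (C * Num.sqrt (rvol Q))%:E)%E].

(* <T1, h^0_{I^1} (x) h^eta_{I^2}>, for I in Q and eta <> 0. In each non-local
   term the side 3Q^m of the strip is split into I^m and 3Q^m \ I^m: the partial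
   kernel of the cube I^m represents the first piece, the full kernel the second.
   Where y_2 ranges over (3Q^2)^c, the kernel value at x_2 = center of I^2 is
   subtracted, which the zero mean of h_{I^2} permits. In the first strip
   h_{I^2} is |I^2|^{-1/2} times the atom |I^2|^{1/2} h_{I^2}. The integrals are
   extended-real valued: finiteness of the pairing is not built in. *)
Definition T1_pairing (T : flagSIO) (Q I : rect R d1 d2)
    (eta : {ffun 'I_d2 -> bool}) : \bar R :=
  let w1 := haar I.1 eta0 in
  let w2 := haar I.2 eta in
  let h := tensor w1 w2 in
  let c := center I.2 in
  let Q1 := cset (triple Q.1) in
  let Q2 := cset (triple Q.2) in
  let I1 := cset I.1 in
  let I2 := cset I.2 in
  let a2 : Rn R d2 -> R := fun x => Num.sqrt (vol I.2) * w2 x in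
  let L1 := kpar1 T I.1 (ind I.1) (ind I.1) in
  let L2 := kpar2 T I.2 (ind I.2) a2 in
  let L1c := fun x y => L1 x y - L1 c y in
  let Kc := fun x y => kfull T x y - kfull T (x.1, c) y in
  ((form T (rind (triple Q.1, triple Q.2)) h)%:E
   + ((Num.sqrt (vol I.2))^-1%:E * kform (leb R d1) L2 \1_(~` Q1) w1
      + kform (leb2 R d1 d2) (kfull T) \1_(~` Q1 `*` (Q2 `\` I2)) h)
   + ((Num.sqrt (vol I.1))^-1%:E
        * kform (leb R d2) L1c \1_(~` Q2) w2
      + kform (leb2 R d1 d2) Kc \1_((Q1 `\` I1) `*` ~` Q2) h)
   + kform (leb2 R d1 d2) Kc \1_(~` Q1 `*` ~` Q2) h)%E.

End flag.

(* Main.v *)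
Require Import Defs.
From mathcomp Require Import all_boot all_order all_algebra.
From mathcomp Require Import all_classical all_reals all_analysis.
From mathcomp Require Import measurable_realfun.
From mathcomp Require Import ring lra.
Import Defs.

Set Implicit Arguments.
Unset Strict Implicit.
Unset Printing Implicit Defensive.

Import Order.TTheory GRing.Theory Num.Theory.
Local Open Scope classical_set_scope.
Local Open Scope ring_scope.

(** Fix a cube Q of side L, a cube I inside Q of side l, and put
    h = h^0_{I^1} (x) h^eta_{I^2}.  The pairing of T1 with h is the local term
    form(1_{3Q}, h) plus five integrals in which y ranges outside 3Q, and the
    two kinds of terms are controlled for different reasons.

    - The functions h, with I running over the equal-sided cubes of the grid
      and eta over the nonzero signatures, are orthonormal in L^2: of two cubes
      of different sizes, the larger one carries a function that is constant on
      the smaller one, whose own function has mean zero because of its second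
      factor ([rect_haar_orthonormal]).  On 3Q the form against 1_{3Q} is
      integration against a function phi with norm at most C |3Q|^{1/2}, so
      Bessel's inequality ([bessel_form]) bounds the sum of the squares of the
      local terms by C^2 |3Q|.

    - Each nonlocal term is at most a constant times
      |I|^{1/2} (l / L)^{alpha/2}, where alpha is the Hoelder exponent in the
      second parameter ([T1_pairing_bound]).  At each scale the cubes I are
      disjoint in Q, so the squares of these bounds sum to a geometric series
      times |Q| ([sum_scales_le]).

    The five nonlocal estimates come from pointwise bounds of the kernels.  If
    y_2 lies outside 3Q^2, subtracting the value at the center of I^2 gains a
    factor (l / |x_2 - y_2|)^alpha ([far_gain]), which is integrable at infinity
    and leaves (l / L)^alpha.  If y_2 lies in 3Q^2 and y_1 lies far away, the
    decay |x_1 - y_1|^{-d1-d2} of the kernel is integrable; when y_2 is in I^2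
    the normalization of the partial kernel supplies the smallness, and
    otherwise the mean zero of h_{I^2} first allows the same subtraction
    ([strip_bound]), the gain being taken only where |x_2 - y_2| exceeds a
    multiple of (l L)^{1/2} ([near_gain]).  If y_1 lies in 3Q^1 but outside I^1,
    the factor |x_1 - y_1|^{-d1} is logarithmically divergent in L / l; that
    costs (L / l)^{alpha/2}, half of what the second parameter gains
    ([offdiag_integral]).

    All these bounds are products of a function of (x_1, y_1) and a function of
    (x_2, y_2), so that Tonelli ([pair_tensor]) leaves double integrals over
    R^n x R^n, which are evaluated by cutting into dyadic shells of
    |x - y| ([shell_integral_le]). *)

(** * Comparison of integrals and integrals of tensor products *)

Section integral_comparison.
Local Open Scope ereal_scope.
Context d (T : measurableType d) (R : realType) (mu : {measure set T -> \bar R}).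
Implicit Types f g : T -> \bar R.

(** The integral of a nonnegative function is a supremum over the simple functions
    below it, hence monotone for the pointwise order.  The kernels, which are
    measurable only off a diagonal, are bounded through this. *)
Lemma le_integral_ge0 f g : (forall x, 0 <= f x) -> (forall x, f x <= g x) ->
  \int[mu]_x f x <= \int[mu]_x g x.
Proof.
move=> f0 fg; have g0 x : 0 <= g x by exact: le_trans (fg x).
rewrite !ge0_integralTE//; apply: le_ereal_sup => _ [h /= hf <-].
by exists h => //= x; exact: le_trans (fg x).
Qed.

Lemma abse_integral_le f g : (forall x, `|f x| <= g x) ->
  `|\int[mu]_x f x| <= \int[mu]_x g x.
Proof.
move=> fg; rewrite integralE.
have fgP x : f^\+ x <= g x.
  by apply: le_trans (fg x); rewrite -/((abse \o f) x) fune_abse leeDl.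
have fgN x : f^\- x <= g x.
  by apply: le_trans (fg x); rewrite -/((abse \o f) x) fune_abse leeDr.
have IP : \int[mu]_x f^\+ x <= \int[mu]_x g x by exact: le_integral_ge0.
have IN : \int[mu]_x f^\- x <= \int[mu]_x g x by exact: le_integral_ge0.
have P0 : 0 <= \int[mu]_x f^\+ x by exact: integral_ge0.
have N0 : 0 <= \int[mu]_x f^\- x by exact: integral_ge0.
have le_g : \int[mu]_x f^\+ x - \int[mu]_x f^\- x <= \int[mu]_x g x.
  by rewrite -[leRHS]adde0; apply: leeD => //; rewrite oppe_le0.
have ge_Ng : - (\int[mu]_x g x) <= \int[mu]_x f^\+ x - \int[mu]_x f^\- x.
  by rewrite -[leLHS]add0e; apply: leeD => //; rewrite leeN2.
have [ge0|lt0] := leP 0 (\int[mu]_x f^\+ x - \int[mu]_x f^\- x).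
  by rewrite gee0_abs.
by rewrite lte0_abs// leeNl.
Qed.

End integral_comparison.

Section tensor_integrals.
Local Open Scope ereal_scope.
Context d1 d2 (T1 : measurableType d1) (T2 : measurableType d2) (R : realType).
Variables (m1 : {sigma_finite_measure set T1 -> \bar R})
          (m2 : {sigma_finite_measure set T2 -> \bar R}).

Lemma ge0_integral_tensor (f : T1 -> \bar R) (g : T2 -> \bar R) :
  (forall x, 0 <= f x) -> (forall y, 0 <= g y) ->
  measurable_fun [set: T1] f -> measurable_fun [set: T2] g ->
  \int[m1 \x m2]_z (f z.1 * g z.2) = \int[m1]_x f x * \int[m2]_y g y.
Proof.
move=> f0 g0 mf mg; rewrite fubini_tonelli1//=; last 2 first.
- apply: emeasurable_funM; first exact: (measurableT_comp mf measurable_fst).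
  exact: (measurableT_comp mg measurable_snd).
- by move=> z; rewrite mule_ge0.
rewrite /fubini_F /=.
under eq_integral do rewrite ge0_integralZl//.
by rewrite ge0_integralZr//; exact: integral_ge0.
Qed.

Lemma integrable_tensor (f : T1 -> R) (g : T2 -> R) :
  m1.-integrable setT (EFin \o f) -> m2.-integrable setT (EFin \o g) ->
  (m1 \x m2).-integrable setT (fun z => (f z.1 * g z.2)%:E).
Proof.
move=> /integrableP[mf If] /integrableP[mg Ig].
apply/integrableP; split.
  apply/measurable_EFinP; apply: measurable_funM.
    by apply: (measurableT_comp _ measurable_fst); exact/measurable_EFinP.
  by apply: (measurableT_comp _ measurable_snd); exact/measurable_EFinP.
under eq_integral do rewrite EFinM abseM.
rewrite (@ge0_integral_tensor (fun x => `|(f x)%:E|) (fun y => `|(g y)%:E|))//.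
- by rewrite lte_mul_pinfty// ?ge0_fin_numE//; exact: integral_ge0.
- exact: measurableT_comp.
- exact: measurableT_comp.
Qed.

Lemma integral_tensor (f : T1 -> R) (g : T2 -> R) :
  m1.-integrable setT (EFin \o f) -> m2.-integrable setT (EFin \o g) ->
  \int[m1 \x m2]_z (f z.1 * g z.2)%:E =
  \int[m1]_x (f x)%:E * \int[m2]_y (g y)%:E.
Proof.
move=> If Ig; rewrite -integral12_prod_meas1; last exact: integrable_tensor.
rewrite /fubini_F /=.
under eq_integral => x _.
  under eq_integral do rewrite EFinM.
  rewrite integralZl//; over.
have /fineK <- : \int[m2]_y (g y)%:E \is a fin_num by exact: integrable_fin_num.
by rewrite integralZr.
Qed.

End tensor_integrals.

(** * Distances, geometric series and dyadic shells *)

Section euclidean_distance.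
Context (R : realType) (n : nat).
Implicit Types x y : Rn R n.

Lemma edist_ge0 x y : 0 <= edist x y.
Proof. exact: sqrtr_ge0. Qed.

Lemma coord_le_edist x y i : `|tnth x i - tnth y i| <= edist x y.
Proof.
rewrite -sqrtr_sqr ler_sqrt ?sumr_ge0// => [|j _]; last exact: sqr_ge0.
by rewrite (bigD1 i)//= lerDl sumr_ge0// => j _; exact: sqr_ge0.
Qed.

Lemma edist_le x y l : 0 <= l -> (forall i, `|tnth x i - tnth y i| <= l) ->
  edist x y <= n%:R * l.
Proof.
move=> l0 H; have nl0 : 0 <= n%:R * l by rewrite mulr_ge0.
rewrite -[leRHS]ger0_norm// -sqrtr_sqr ler_sqrt; last exact: sqr_ge0.
apply: (@le_trans _ _ (\sum_(i < n) l ^+ 2)).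
  apply: ler_sum => i _; rewrite -[leLHS]real_normK ?num_real//.
  by rewrite lerXn2r ?nnegrE//.
rewrite sumr_const card_ord exprMn -[leLHS]mulr_natl ler_wpM2r ?sqr_ge0//.
by rewrite -natrX ler_nat; case: (n) => // m; rewrite leq_pmulr.
Qed.

Lemma edist_gt0 x y : x <> y -> 0 < edist x y.
Proof.
move=> xy; rewrite lt_neqAle edist_ge0 andbT; apply/eqP => e0; apply: xy.
apply: eq_from_tnth => i; apply/eqP; rewrite -subr_eq0 -normr_eq0.
by rewrite eq_le normr_ge0 andbT e0 coord_le_edist.
Qed.

Lemma measurable_edist d (T : measurableType d) (f g : T -> Rn R n) :
  measurable_fun [set: T] f -> measurable_fun [set: T] g ->
  measurable_fun [set: T] (fun z => edist (f z) (g z)).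
Proof.
move=> mf mg; apply: (@measurableT_comp _ _ _ _ _ _ (@Num.sqrt R)).
  by apply: continuous_measurable_fun => z; exact: sqrt_continuous.
apply: measurable_sum => i; apply: measurable_funX; apply: measurable_funB.
  exact: (measurableT_comp (measurable_tnth i) mf).
exact: (measurableT_comp (measurable_tnth i) mg).
Qed.

End euclidean_distance.

Section geometric.
Context (R : realType).

Lemma sum_geometric_le (q : R) N : 0 <= q < 1 ->
  \sum_(k < N) q ^+ k <= (1 - q)^-1.
Proof.
move=> /andP[q0 q1]; have q1' : 0 < 1 - q by rewrite subr_gt0.
rewrite -[leRHS]mul1r ler_pdivlMr// mulrC.
have -> : (1 - q) * \sum_(k < N) q ^+ k = 1 - q ^+ N.
  by rewrite -[RHS]opprB subrX1 -mulNr opprB.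
by rewrite gerBl exprn_ge0.
Qed.

Lemma powR_half_lt1 (b : R) : 0 < b -> 0 <= (2 : R) `^ (- b) < 1.
Proof.
move=> b0; rewrite powR_ge0/= powRN invf_lt1 ?powR_gt0//.
rewrite -[ltLHS](powRr0 2) /powR ifF; last by apply/eqP => /eqP; rewrite pnatr_eq0.
by rewrite ifF ?ltr_expR ?mul0r ?mulr_gt0 ?ln_gt0 ?ltr1n//; apply/eqP => /eqP; rewrite pnatr_eq0.
Qed.

Lemma dyadic_shell (r D : R) : 0 < r -> r <= D ->
  exists k, 2 ^+ k * r <= D < 2 ^+ k.+1 * r.
Proof.
move=> r0 rD.
have ex : exists k, D < 2 ^+ k.+1 * r.
  exists (Num.truncn (D / r)); rewrite -ltr_pdivrMr//.
  apply: lt_le_trans (truncnS_gt _) _.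
  by rewrite -natrX ler_nat; by apply: ltnW; exact: ltn_expl.
exists (ex_minn ex); case: ex_minnP => -[|k] Dk kmin; apply/andP; split=> //.
  by rewrite expr0 mul1r.
by rewrite leNgt; apply/negP => /kmin; rewrite ltnn.
Qed.

End geometric.

(** * Double integrals of powers of the distance *)

Section pair_integrals.
Context (R : realType) (n : nat).
Local Notation X := (Rn R n).

Definition near_pairs (r : R) : set (X * X) := [set z | edist z.1 z.2 < r].

Lemma measurable_edist_pair : measurable_fun [set: X * X] (fun z => edist z.1 z.2).
Proof. by apply: measurable_edist; [exact: measurable_fst|exact: measurable_snd]. Qed.

Lemma measurable_near_pairs r : measurable (near_pairs r).
Proof.
rewrite (_ : near_pairs r = [set: X * X] `&` (fun z => edist z.1 z.2) @^-1` `]-oo, r[).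
  exact: measurable_edist_pair.
by rewrite setTI; apply/seteqP; split=> z /=; rewrite in_itv.
Qed.

Lemma leb_ball (x : X) (r : R) : 0 < r ->
  (leb R n [set y | edist x y < r]%R <= ((2 * r) ^+ n)%:E)%E.
Proof.
move=> r0; have r20 : 0 < 2 * r by rewrite mulr_gt0.
pose J : cube R n := ([tuple tnth x i - r | i < n], PosNum r20).
have -> : ((2 * r) ^+ n)%:E = leb R n (cset J) by rewrite leb_cset.
apply: le_measure; rewrite ?inE.
- rewrite (_ : [set _ | _] = [set: X] `&` (fun y => edist x y) @^-1` `]-oo, r[).
    by apply: measurable_edist => //; exact: measurable_cst.
  by rewrite setTI; apply/seteqP; split=> z /=; rewrite in_itv.
- exact: measurable_cset.
- move=> y /= xy i; rewrite /J /side /= tnth_mktuple.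
  have := le_lt_trans (coord_le_edist x y i) xy; rewrite ltr_norml; lra.
Qed.

Lemma near_integral (E : set X) (r : R) : measurable E -> 0 < r ->
  (\int[leb R n \x leb R n]_z (\1_E z.1 * \1_(near_pairs r) z : R)%:E
    <= leb R n E * ((2 * r) ^+ n)%:E)%E.
Proof.
move=> mE r0; rewrite fubini_tonelli1; last 2 first.
- apply/measurable_EFinP; apply: measurable_funM.
    exact: (measurableT_comp (measurable_indic mE) measurable_fst).
  by apply: measurable_indic; exact: measurable_near_pairs.
- by move=> z; rewrite lee_fin mulr_ge0.
have -> : leb R n E = (\int[leb R n]_x (\1_E x)%:E)%E.
  by rewrite integral_indic// setIT.
rewrite /fubini_F.
have c0 : 0 <= (2 * r) ^+ n by rewrite exprn_ge0 ?mulr_ge0 ?(ltW r0).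
rewrite -[leRHS]ge0_integralZr ?lee_fin//; last first.
  exact/measurable_EFinP/measurable_indic.
apply: le_integral_ge0 => x.
  by apply: integral_ge0 => y _; rewrite lee_fin mulr_ge0.
have mball : measurable [set y | edist x y < r]%R.
  rewrite (_ : [set _ | _] = [set: X] `&` (fun y => edist x y) @^-1` `]-oo, r[).
    by apply: measurable_edist => //; exact: measurable_cst.
  by rewrite setTI; apply/seteqP; split=> z /=; rewrite in_itv.
have -> : (\int[leb R n]_y (\1_E (x, y).1 * \1_(near_pairs r) (x, y) : R)%:E =
    (\1_E x)%:E * \int[leb R n]_y (\1_[set y | edist x y < r]%R y)%:E)%E.
  rewrite -ge0_integralZl//.
  exact/measurable_EFinP/measurable_indic.
apply: lee_wpmul2l; first by rewrite lee_fin.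
by rewrite integral_indic// setIT; exact: leb_ball.
Qed.

End pair_integrals.

Section shells.
Context (R : realType) (n : nat).
Local Notation X := (Rn R n).

(** The point of cutting into shells: on the k-th piece [u] is at most [c k], the
    second variable stays in a ball of radius [r k] around the first, and the
    first variable stays in [E k].  The constants are arranged so that the pieces
    contribute the terms of a geometric series. *)
Lemma shell_integral_le (u : X * X -> R) (E : nat -> set X) (c r : nat -> R)
    (A q : R) :
  (forall z, 0 <= u z) -> (forall k, measurable (E k)) ->
  (forall k, 0 <= c k) -> (forall k, 0 < r k) -> 0 <= q < 1 ->
  (forall k, (c k)%:E * (leb R n (E k) * ((2 * r k) ^+ n)%:E) <= (A * q ^+ k)%:E)%E ->
  (forall z, u z != 0 ->
     exists k, [/\ E k z.1, edist z.1 z.2 < r k & u z <= c k]) ->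
  (\int[leb R n \x leb R n]_z (u z)%:E <= (A / (1 - q))%:E)%E.
Proof.
move=> u0 mE c0 r0 q01 cA uE.
pose f k (z : X * X) := ((c k)%:E * (\1_(E k) z.1 * \1_(near_pairs (r k)) z : R)%:E)%E.
have f0 k z : (0 <= f k z)%E by rewrite mule_ge0// lee_fin// mulr_ge0.
have mfk k : measurable_fun [set: X * X]
    (fun z => (\1_(E k) z.1 * \1_(near_pairs (r k)) z : R)%:E).
  apply/measurable_EFinP; apply: measurable_funM.
    exact: (measurableT_comp (measurable_indic (mE k)) measurable_fst).
  by apply: measurable_indic; exact: measurable_near_pairs.
apply: (@le_trans _ _ (\int[leb R n \x leb R n]_z \sum_(k <oo) f k z)%E).
  apply: le_integral_ge0 => z; first by rewrite lee_fin.
  have [->|/uE[k [Ez zr uc]]] := eqVneq (u z) 0.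
    by apply: nneseries_ge0 => k _ _.
  apply: (@le_trans _ _ (f k z)).
    by rewrite /f !indicE !mem_set// !mulr1 mule1 lee_fin.
  apply: (@le_trans _ _ (\sum_(0 <= i < k.+1) f i z)%E); last first.
    by apply: nneseries_lim_ge => i _ _.
  rewrite big_nat_recr//= leeDr//; exact: sume_ge0.
rewrite integral_nneseries//; last by move=> k; exact: measurable_funeM.
apply: lime_le.
  by apply: is_cvg_nneseries => k _ _; exact: integral_ge0.
apply: nearW => N.
apply: (@le_trans _ _ (\sum_(k < N) (A * q ^+ k)%:E)%E).
  rewrite big_mkord; apply: lee_sum => k _.
  apply: le_trans (cA k); rewrite /f ge0_integralZl ?lee_fin//.
  apply: lee_wpmul2l; first by rewrite lee_fin.
  exact: near_integral.
rewrite sumEFin lee_fin -mulr_sumr.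
have A0 : 0 <= A.
  rewrite -lee_fin; have := cA 0; rewrite expr0 mulr1; apply: le_trans.
  by rewrite !mule_ge0// lee_fin ?exprn_ge0// mulr_ge0// ltW.
by rewrite ler_wpM2l// sum_geometric_le.
Qed.

End shells.

Section power_arithmetic.
Context (R : realType).

Lemma ler_powRN (a b p : R) : 0 < a -> a <= b -> 0 <= p -> b `^ (- p) <= a `^ (- p).
Proof.
move=> a0 ab p0; have b0 : 0 < b := lt_le_trans a0 ab.
rewrite !powRN lef_pV2 ?posrE ?powR_gt0//.
by apply: ge0_ler_powR; rewrite // nnegrE ltW.
Qed.

Lemma powR_exprn (a p : R) k : 0 <= a -> (a ^+ k) `^ p = (a `^ p) ^+ k.
Proof.
by move=> a0; rewrite -(powR_mulrn k a0) -(powR_mulrn k (powR_ge0 a p)) powRAC.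
Qed.

(** The volume of a ball of radius [s] cancels the critical part of the kernel
    power and leaves a decaying power of [s]. *)
Lemma powR_expr_cancel (s b : R) n : 0 < s ->
  s `^ (- (n%:R + b)) * s ^+ n = s `^ (- b).
Proof.
move=> s0; have sn : s != 0 by rewrite gt_eqF.
rewrite -powR_mulrn ?ltW// -powRD; last by rewrite sn implybT.
by congr (_ `^ _); ring.
Qed.

End power_arithmetic.

Section kernel_integrals.
Context (R : realType) (n : nat).
Local Notation X := (Rn R n).
Implicit Types (I : cube R n) (z : X * X).

(** The weight |x - y|^{-n-b} for x in I and |x - y| >= r. *)
Definition far_weight I (r b : R) z : R :=
  \1_(cset I) z.1 * (\1_(~` near_pairs r) z * edist z.1 z.2 `^ (- (n%:R + b))).

Definition far_const (b : R) : R := 4 ^+ n / (1 - 2 `^ (- b)).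

Lemma far_weight_ge0 I r b z : 0 <= far_weight I r b z.
Proof. by rewrite !mulr_ge0// powR_ge0. Qed.

(** Shells |x - y| ~ 2^k r: each contributes (2^k r)^{-b}, up to a constant. *)
Lemma far_integral I (r b : R) : 0 < r -> 0 < b ->
  (\int[leb R n \x leb R n]_z (far_weight I r b z)%:E
   <= (far_const b * (vol I * r `^ (- b)))%:E)%E.
Proof.
move=> r0 b0; have vI0 : 0 <= vol I by rewrite exprn_ge0// /side.
have s0 k : 0 < 2 ^+ k * r by rewrite mulr_gt0 ?exprn_gt0.
rewrite [X in (_ <= X%:E)%E](_ : _ =
  (4 ^+ n * vol I * r `^ (- b)) / (1 - 2 `^ (- b))); last by rewrite /far_const; ring.
apply: (@shell_integral_le _ _ _ (fun=> cset I)
  (fun k => (2 ^+ k * r) `^ (- (n%:R + b))) (fun k => 2 ^+ k.+1 * r)).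
- by move=> z; exact: far_weight_ge0.
- by move=> k; exact: measurable_cset.
- by move=> k; exact: powR_ge0.
- by move=> k.
- exact: powR_half_lt1.
- move=> k; rewrite leb_cset -!EFinM lee_fin.
  rewrite (_ : 2 * _ = 4 * (2 ^+ k * r)); last by rewrite exprS; ring.
  rewrite exprMn [X in X <= _](_ : _ = (4 ^+ n * vol I) *
    ((2 ^+ k * r) `^ (- (n%:R + b)) * (2 ^+ k * r) ^+ n)); last by ring.
  rewrite powR_expr_cancel// powRM ?exprn_ge0 ?(ltW r0)// powR_exprn//.
  by rewrite -!mulrA (mulrC ((2 `^ (- b)) ^+ k)).
- move=> z; rewrite /far_weight !indicE; case: (boolP (z.1 \in _)) => Iz; last first.
    by rewrite mul0r eqxx.
  case: (boolP (z \in _)) => [/set_mem/= rz _|]; last by rewrite !mul0r mulr0 eqxx.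
  have rD : r <= edist z.1 z.2 by rewrite leNgt; exact/negP.
  have [k /andP[k1 k2]] := dyadic_shell r0 rD.
  exists k; split=> //; first exact: set_mem.
  by rewrite !mul1r; apply: ler_powRN => //; rewrite addr_ge0// ltW.
Qed.

End kernel_integrals.

Section boundary.
Context (R : realType) (n : nat).
Local Notation X := (Rn R n).
Implicit Types (I : cube R n) (z : X * X).

Definition core I (s : R) : set X :=
  [set x | forall i, tnth I.1 i + s <= tnth x i < tnth I.1 i + side I - s].

Lemma core_near I s x y : cset I x -> ~ cset I y -> edist x y <= s -> ~ core I s x.
Proof.
move=> Ix Iy xy xs; apply: Iy => i.
have := le_trans (coord_le_edist x y i) xy; rewrite ler_norml => /andP[h1 h2].
by have := xs i; lra.
Qed.

(** Bernoulli's inequality, for the volume between a cube and a concentric smaller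
    one. *)
Lemma exprB_le (a s : R) m : 0 <= s -> s <= a ->
  a ^+ m - (a - s) ^+ m <= m%:R * s * a ^+ m.-1.
Proof.
move=> s0 sa; have a0 : 0 <= a := le_trans s0 sa.
case: m => [|m]; first by rewrite !expr0 subrr !mul0r.
rewrite subrXX (_ : a - (a - s) = s); last by ring.
rewrite (mulrC _ s) -mulrA; apply: ler_wpM2l => //=.
rewrite [leRHS](_ : _ = \sum_(i < m.+1) a ^+ m); last first.
  by rewrite sumr_const card_ord mulr_natl.
apply: ler_sum => i _; rewrite [leRHS](_ : _ = a ^+ (m.+1 - i.+1) * a ^+ i); last first.
  by rewrite -exprD; congr (_ ^+ _); rewrite subSS subnK// -ltnS.
by rewrite ler_wpM2l ?exprn_ge0// lerXn2r// ?nnegrE ?subr_ge0// gerBl.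
Qed.

(** A boundary layer of width [s] is the difference of two cubes, hence its
    measure is linear in [s]. *)
Lemma layerP I s : (0 < n)%N -> 0 < s ->
  measurable (cset I `\` core I s) /\
  (leb R n (cset I `\` core I s) <= (2 * n%:R * s * side I ^+ n.-1)%:E)%E.
Proof.
move=> n0 s0; have l0 : 0 < side I by rewrite /side.
have [s2|s2] := ltP (2 * s) (side I).
  have e0 : 0 < side I - 2 * s by rewrite subr_gt0.
  pose J : cube R n := ([tuple tnth I.1 i + s | i < n], PosNum e0).
  have -> : core I s = cset J.
    apply/seteqP; split=> x /= h i; have := h i.
      by rewrite /J /side/= tnth_mktuple /side; lra.
    by rewrite /J /side/= tnth_mktuple /side; lra.
  have mI := measurable_cset I; have mJ := measurable_cset J.
  split; first exact: measurableD.
  rewrite measureD//; last by rewrite [X in (X < _)%E]leb_cset ltry.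
  have JI : cset J `<=` cset I.
    by move=> x /= h i; have := h i; rewrite /J /side/= tnth_mktuple /side; lra.
  rewrite (setIidr JI) [X in (X - _)%E]leb_cset [X in (_ - X)%E]leb_cset.
  rewrite -EFinB lee_fin /vol [side J]/=.
  have -> : 2 * n%:R * s = n%:R * (2 * s) by ring.
  by apply: exprB_le; lra.
have -> : core I s = set0.
  by apply/seteqP; split=> // x /= h; have := h (Ordinal n0); lra.
rewrite setD0; split; first exact: measurable_cset.
rewrite leb_cset lee_fin /vol.
have -> : side I ^+ n = side I * side I ^+ n.-1 by rewrite -exprS prednK.
apply: ler_wpM2r; first by rewrite exprn_ge0// ltW.
apply: le_trans s2 _; rewrite mulrAC ler_peMr ?mulr_ge0 ?(ltW s0)//.
by rewrite ler1n.
Qed.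

(** The singular power |x - y|^{-n-e} across the boundary of a cube is integrable
    for e < 1: if |x - y| ~ s then x lies in a boundary layer of width s, whose
    measure contributes a factor s, against a loss of s^{-e}. *)
Lemma boundary_integral I (e : R) : (0 < n)%N -> 0 < e -> e <= 1 / 2 ->
  (\int[leb R n \x leb R n]_z
     (\1_(cset I) z.1 * (\1_(~` cset I) z.2 * (\1_(near_pairs (side I)) z
        * edist z.1 z.2 `^ (- (n%:R + e)))))%:E
   <= (8 ^+ n * (4 * n%:R) / (1 - 2 `^ (- (1 - e))) * (vol I * side I `^ (- e)))%:E)%E.
Proof.
move=> n0 e0 e1; have l0 : 0 < side I by rewrite /side.
set l := side I in l0 *.
(* Shell k: s k < |x - y| <= 2 s k, with 2 s 0 the side of the cube. *)
pose s k := (2 ^+ k.+1)^-1 * l.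
have s0 k : 0 < s k by rewrite mulr_gt0// invr_gt0 exprn_gt0.
rewrite [X in (_ <= X%:E)%E](_ : _ =
  (8 ^+ n * (4 * n%:R) * (vol I * l `^ (- e))) / (1 - 2 `^ (- (1 - e)))); last by ring.
apply: (@shell_integral_le _ _ _ (fun k => cset I `\` core I (2 * s k))
  (fun k => s k `^ (- (n%:R + e))) (fun k => 4 * s k)).
- by move=> z; rewrite !mulr_ge0// powR_ge0.
- by move=> k; apply: (layerP _ _ _).1 => //; rewrite mulr_gt0.
- by move=> k; exact: powR_ge0.
- by move=> k; rewrite mulr_gt0.
- by apply: powR_half_lt1; lra.
- move=> k; set c := s k `^ _.
  have c0 : 0 <= c by exact: powR_ge0.
  have m0 : 0 < 2 * s k by rewrite mulr_gt0.
  apply: (@le_trans _ _ (c%:E *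
     ((2 * n%:R * (2 * s k) * l ^+ n.-1)%:E * ((2 * (4 * s k)) ^+ n)%:E))%E).
    apply: lee_wpmul2l; first by rewrite lee_fin.
    apply: lee_wpmul2r; last exact: (layerP I n0 m0).2.
    by rewrite lee_fin exprn_ge0// !mulr_ge0// ltW.
  rewrite -!EFinM lee_fin (_ : 2 * (4 * s k) = 8 * s k); last by ring.
  rewrite exprMn [leLHS](_ : _ = 8 ^+ n * (4 * n%:R) * (l ^+ n.-1 *
    (s k * (c * s k ^+ n)))); last by ring.
  rewrite /c powR_expr_cancel// -[leRHS]mulrA.
  apply: ler_wpM2l; first by rewrite mulr_ge0// exprn_ge0.
  have -> : s k * s k `^ (- e) = s k `^ (1 - e).
    rewrite powRD; last by rewrite (gt_eqF (s0 k)) implybT.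
    by rewrite powRr1// ltW.
  have -> : vol I = l ^+ n.-1 * l by rewrite -exprSr prednK.
  rewrite -!mulrA; apply: ler_wpM2l; first by rewrite exprn_ge0// ltW.
  have -> : l * (l `^ (- e) * (2 `^ (- (1 - e))) ^+ k) =
            (2 ^+ k)^-1 `^ (1 - e) * l `^ (1 - e).
    rewrite [X in _ = _ * X]powRD; last by rewrite (gt_eqF l0) implybT.
    rewrite powRr1; last exact: ltW.
    rewrite -powR_inv1 ?exprn_ge0// -powRrM mulN1r powR_exprn//.
    by ring.
  rewrite -powRM ?invr_ge0 ?exprn_ge0 ?(ltW l0)//.
  apply: ge0_ler_powR; rewrite ?nnegrE ?mulr_ge0 ?invr_ge0 ?exprn_ge0 ?(ltW l0)//; first lra.
  rewrite /s exprS invfM -mulrA ler_piMl ?mulr_ge0 ?invr_ge0 ?exprn_ge0 ?(ltW l0)//.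
  lra.
- move=> z; rewrite !indicE.
  case: (boolP (z.1 \in _)) => [/set_mem Iz|]; last by rewrite mul0r eqxx.
  case: (boolP (z.2 \in _)) => [/set_mem Iz2|]; last by rewrite !mul0r mulr0 eqxx.
  case: (boolP (z \in _)) => [/set_mem/= zl _|]; last by rewrite !mul0r !mulr0 eqxx.
  have D0 : 0 < edist z.1 z.2 by apply: edist_gt0 => zz; apply: Iz2; rewrite -zz.
  have [k /andP[k1 k2]] := dyadic_shell D0 (ltW zl).
  have D1 : edist z.1 z.2 <= 2 * s k.
    rewrite /s exprS invfM mulrA mulrA mulfV// mul1r mulrC ler_pdivlMr ?exprn_gt0//.
    by rewrite mulrC.
  have D2 : s k < edist z.1 z.2.
    by rewrite /s mulrC ltr_pdivrMr ?exprn_gt0// mulrC.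
  exists k; split.
  + by split=> //; exact: (core_near Iz Iz2).
  + by apply: le_lt_trans D1 _; have := s0 k; lra.
  + rewrite !mul1r; by apply: ler_powRN; rewrite ?(ltW D2)// addr_ge0// ltW.
Qed.

End boundary.

Section pair_weights.
Context (R : realType) (n : nat).
Local Notation X := (Rn R n).
Implicit Types (I J : cube R n) (z : X * X) (B : set X).

Definition boundary_const (e : R) : R :=
  far_const n e + 8 ^+ n * (4 * n%:R) / (1 - 2 `^ (- (1 - e))).

Lemma measurable_powR_edist (p : R) :
  measurable_fun [set: X * X] (fun z => edist z.1 z.2 `^ p).
Proof.
by apply: (@measurableT_comp _ _ _ _ _ _ (@powR R ^~ p)) => //;
  exact: measurable_edist_pair.
Qed.

Lemma measurable_indic_fst B : measurable B ->
  measurable_fun [set: X * X] (fun z => \1_B z.1 : R).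
Proof. by move=> mB; exact: (measurableT_comp (measurable_indic mB) measurable_fst). Qed.

Lemma measurable_indic_snd B : measurable B ->
  measurable_fun [set: X * X] (fun z => \1_B z.2 : R).
Proof. by move=> mB; exact: (measurableT_comp (measurable_indic mB) measurable_snd). Qed.

Lemma measurable_indic_near (r : R) :
  measurable_fun [set: X * X] (fun z => \1_(near_pairs r) z : R).
Proof. by apply: measurable_indic; exact: measurable_near_pairs. Qed.

Lemma measurable_indic_far (r : R) :
  measurable_fun [set: X * X] (fun z => \1_(~` near_pairs r) z : R).
Proof. by apply: measurable_indic; apply: measurableC; exact: measurable_near_pairs. Qed.

Lemma measurable_far_weight I (r b : R) : measurable_fun [set: X * X] (far_weight I r b).
Proof.
apply: measurable_funM; first by apply: measurable_indic_fst; exact: measurable_cset.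
by apply: measurable_funM; [exact: measurable_indic_far|exact: measurable_powR_edist].
Qed.

Definition offdiag_weight I B z : R :=
  \1_(cset I) z.1 * (\1_(B `\` cset I) z.2 * (edist z.1 z.2 ^+ n)^-1).

Lemma offdiag_weight_ge0 I B z : 0 <= offdiag_weight I B z.
Proof. by rewrite !mulr_ge0// invr_ge0 exprn_ge0// edist_ge0. Qed.

Lemma measurable_offdiag_weight I B : measurable B ->
  measurable_fun [set: X * X] (offdiag_weight I B).
Proof.
move=> mB; have mI := measurable_cset I.
apply: measurable_funM; first exact: measurable_indic_fst.
apply: measurable_funM; first by apply: measurable_indic_snd; exact: measurableD.
rewrite (_ : (fun z => _) = (fun z => edist z.1 z.2 `^ (- n%:R))).
  exact: measurable_powR_edist.
by apply/funext => z; rewrite powR_invn// edist_ge0.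
Qed.

(** The critical power |x - y|^{-n} between a cube and its surroundings of radius
    [D].  Its true size is 1 + log (D / side I); a small power is enough, and is
    obtained by trading |x - y|^{-n} for D^e |x - y|^{-n-e}, which is integrable
    both near the boundary of the cube and at infinity. *)
Lemma offdiag_integral I B (D e : R) : (0 < n)%N -> 0 < e -> e <= 1 / 2 -> 0 <= D ->
  (forall x y, cset I x -> B y -> edist x y <= D) ->
  (\int[leb R n \x leb R n]_z (offdiag_weight I B z)%:E
   <= (boundary_const e * (vol I * (D / side I) `^ e))%:E)%E.
Proof.
move=> n0 e0 e1 D_ge0 ID; have l0 : 0 < side I by rewrite /side.
have mI := measurable_cset I.
pose f := far_weight I (side I) e.
pose g z : R := \1_(cset I) z.1 * (\1_(~` cset I) z.2 *
   (\1_(near_pairs (side I)) z * edist z.1 z.2 `^ (- (n%:R + e)))).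
have f0 z : 0 <= f z by exact: far_weight_ge0.
have g0 z : 0 <= g z by rewrite !mulr_ge0// powR_ge0.
have mf : measurable_fun [set: X * X] f by exact: measurable_far_weight.
have mg : measurable_fun [set: X * X] g.
  apply: measurable_funM; first exact: measurable_indic_fst.
  apply: measurable_funM; first by apply: measurable_indic_snd; exact: measurableC.
  by apply: measurable_funM; [exact: measurable_indic_near|exact: measurable_powR_edist].
apply: (@le_trans _ _ (\int[leb R n \x leb R n]_z
    ((D `^ e)%:E * ((f z)%:E + (g z)%:E)))%E).
  apply: le_integral_ge0 => z.
    by rewrite lee_fin offdiag_weight_ge0.
  rewrite -EFinD -EFinM lee_fin /f /g /offdiag_weight /far_weight !indicE.
  case: (boolP (z.1 \in _)) => [/set_mem Iz|]; last by rewrite !mul0r addr0 mulr0.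
  case: (boolP (z.2 \in _)) => [/set_mem[Bz Iz2]|_]; last first.
    by rewrite mul0r mulr0 mulr_ge0 ?powR_ge0// addr_ge0// !mulr_ge0// powR_ge0.
  have D0 : 0 < edist z.1 z.2 by apply: edist_gt0 => zz; apply: Iz2; rewrite -zz.
  rewrite !mul1r (mem_set (Iz2 : (~` cset I) z.2)) mul1r -mulrDl.
  have -> : ((z \in ~` near_pairs (side I))%:R + (z \in near_pairs (side I))%:R : R) = 1.
    by rewrite in_setC; case: (_ \in _); rewrite ?addr0 ?add0r.
  rewrite mul1r opprD powRD; last by rewrite (gt_eqF D0) implybT.
  rewrite powR_invn ?(ltW D0)// mulrCA -[leLHS]mulr1.
  apply: ler_wpM2l; first by rewrite invr_ge0 exprn_ge0// ltW.
  rewrite powRN ler_pdivlMr ?powR_gt0// mul1r.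
  have zD := ID _ _ Iz Bz.
  by apply: ge0_ler_powR; rewrite ?nnegrE ?(ltW e0) ?(ltW D0)// (le_trans _ zD)// ltW.
rewrite ge0_integralZl ?lee_fin ?powR_ge0//; last 2 first.
- by apply: emeasurable_funD; exact/measurable_EFinP.
- by move=> z _; rewrite adde_ge0// lee_fin.
rewrite ge0_integralD//; [|by move=> z _; rewrite lee_fin|exact/measurable_EFinP|
  by move=> z _; rewrite lee_fin|exact/measurable_EFinP].
have F := far_integral I l0 e0; have G := boundary_integral I n0 e0 e1.
apply: (le_trans (lee_wpmul2l _ (leeD F G))); first by rewrite lee_fin powR_ge0.
have D0 : 0 <= D by exact: D_ge0.
have -> : (D / side I) `^ e = D `^ e * side I `^ (- e).
  by rewrite powRM// ?invr_ge0 ?(ltW l0)// -powR_inv1 ?(ltW l0)// -powRrM mulN1r.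
rewrite -EFinD -EFinM lee_fin.
by rewrite /boundary_const le_eqVlt; apply/orP; left; apply/eqP; ring.
Qed.

(** A constant [a] on [J] together with a bump on the diagonal: the shape of the
    bound produced by [near_gain]. *)
Definition diag_weight I J (a r : R) z : R :=
  \1_(cset I) z.1 * (a * \1_(cset J) z.2 + \1_(near_pairs r) z).

Lemma diag_weight_ge0 I J (a r : R) z : 0 <= a -> 0 <= diag_weight I J a r z.
Proof. by move=> a0; rewrite mulr_ge0// addr_ge0// mulr_ge0. Qed.

Lemma measurable_diag_weight I J (a r : R) :
  measurable_fun [set: X * X] (diag_weight I J a r).
Proof.
apply: measurable_funM; first by apply: measurable_indic_fst; exact: measurable_cset.
apply: measurable_funD; last exact: measurable_indic_near.
by apply: measurable_funM => //; apply: measurable_indic_snd; exact: measurable_cset.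
Qed.

Lemma diag_integral I J (a r : R) : 0 <= a -> 0 < r ->
  (\int[leb R n \x leb R n]_z (diag_weight I J a r z)%:E
   <= (vol I * (a * vol J + (2 * r) ^+ n))%:E)%E.
Proof.
move=> a0 r0; have mI := measurable_cset I; have mJ := measurable_cset J.
pose f z : R := \1_(cset I) z.1 * \1_(cset J) z.2.
pose g z : R := \1_(cset I) z.1 * \1_(near_pairs r) z.
have f0 z : 0 <= f z by rewrite !mulr_ge0// powR_ge0.
have g0 z : 0 <= g z by rewrite !mulr_ge0// powR_ge0.
have mf : measurable_fun [set: X * X] f.
  by apply: measurable_funM; [exact: measurable_indic_fst|exact: measurable_indic_snd].
have mg : measurable_fun [set: X * X] g.
  by apply: measurable_funM; [exact: measurable_indic_fst|exact: measurable_indic_near].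
rewrite [leLHS](_ : _ = \int[leb R n \x leb R n]_z (a%:E * (f z)%:E + (g z)%:E))%E; last first.
  by apply: eq_integral => z _; rewrite -EFinM -EFinD /f /g; congr EFin; rewrite /diag_weight; ring.
rewrite ge0_integralD//; last 4 first.
- by move=> z _; rewrite mule_ge0// lee_fin.
- by apply: measurable_funeM; exact/measurable_EFinP.
- by move=> z _; rewrite lee_fin.
- exact/measurable_EFinP.
rewrite ge0_integralZl ?lee_fin//; [|exact/measurable_EFinP|by move=> z _; rewrite lee_fin].
rewrite mulrDr EFinD; apply: leeD.
  rewrite mulrCA EFinM; apply: lee_wpmul2l; first by rewrite lee_fin.
  under eq_integral do rewrite EFinM.
  rewrite (@ge0_integral_tensor _ _ _ _ _ _ _
    (fun x => (\1_(cset I) x)%:E) (fun x => (\1_(cset J) x)%:E))//;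
    [|exact/measurable_EFinP/measurable_indic|exact/measurable_EFinP/measurable_indic].
  by rewrite !integral_indic// !setIT [X in (X * _)%E]leb_cset [X in (_ * X)%E]leb_cset EFinM.
by rewrite EFinM -leb_cset; exact: near_integral.
Qed.

End pair_weights.

(** * Factorization of integrals over pairs of points *)

Section pair_tensor.
Context (R : realType) (d1 d2 : nat).
Local Notation Rd := (Rn R d1 * Rn R d2)%type.

(** Kernel bounds are products of one function of (x_1, y_1) and one function of
    (x_2, y_2); regrouping the four variables reduces everything to one parameter. *)
Lemma pair_tensor (u1 : Rn R d1 * Rn R d1 -> R) (u2 : Rn R d2 * Rn R d2 -> R) :
  (forall z, 0 <= u1 z) -> (forall z, 0 <= u2 z) ->
  measurable_fun [set: Rn R d1 * Rn R d1] u1 ->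
  measurable_fun [set: Rn R d2 * Rn R d2] u2 ->
  (\int[leb2 R d1 d2 \x leb2 R d1 d2]_z
      (u1 (z.1.1, z.2.1) * u2 (z.1.2, z.2.2))%:E =
   \int[leb R d1 \x leb R d1]_z (u1 z)%:E * \int[leb R d2 \x leb R d2]_z (u2 z)%:E)%E.
Proof.
move=> u10 u20 mu1 mu2.
have m1 : measurable_fun [set: Rd * Rd] (fun z : Rd * Rd => u1 (z.1.1, z.2.1)).
  apply: (measurableT_comp mu1); apply: measurable_fun_pair.
    exact: (measurableT_comp measurable_fst measurable_fst).
  exact: (measurableT_comp measurable_fst measurable_snd).
have m2 : measurable_fun [set: Rd * Rd] (fun z : Rd * Rd => u2 (z.1.2, z.2.2)).
  apply: (measurableT_comp mu2); apply: measurable_fun_pair.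
    exact: (measurableT_comp measurable_snd measurable_fst).
  exact: (measurableT_comp measurable_snd measurable_snd).
rewrite fubini_tonelli1; last 2 first.
- by apply/measurable_EFinP; exact: measurable_funM.
- by move=> z; rewrite lee_fin mulr_ge0.
pose F1 := fubini_F (leb R d1) (EFin \o u1).
pose F2 := fubini_F (leb R d2) (EFin \o u2).
have e1 : measurable_fun [set: Rn R d1 * Rn R d1] (EFin \o u1) by exact/measurable_EFinP.
have e2 : measurable_fun [set: Rn R d2 * Rn R d2] (EFin \o u2) by exact/measurable_EFinP.
transitivity (\int[leb R d1 \x leb R d2]_x (F1 x.1 * F2 x.2))%E.
  apply: eq_integral => x _; rewrite /fubini_F /=.
  under eq_integral do rewrite EFinM.
  rewrite (@ge0_integral_tensor _ _ _ _ _ (leb R d1) (leb R d2)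
    (fun y => (u1 (x.1, y))%:E) (fun y => (u2 (x.2, y))%:E))//.
  - by move=> y; rewrite lee_fin.
  - by move=> y; rewrite lee_fin.
  - exact/measurable_EFinP/(measurableT_comp mu1).
  - exact/measurable_EFinP/(measurableT_comp mu2).
rewrite ge0_integral_tensor.
- by rewrite !fubini_tonelli1// => z; rewrite lee_fin.
- by move=> x; apply: integral_ge0 => y _; rewrite lee_fin.
- by move=> x; apply: integral_ge0 => y _; rewrite lee_fin.
- by apply: measurable_fun_fubini_tonelli_F => // z; rewrite lee_fin.
- by apply: measurable_fun_fubini_tonelli_F => // z; rewrite lee_fin.
Qed.

End pair_tensor.

(** * Haar functions of a cube *)

Section product_functions.
Context (R : realType).

Lemma tnth_cons0 n (z : measurableTypeR R * Rn R n) : tnth (Rn_cons z) ord0 = z.1.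
Proof. by []. Qed.

Lemma tnth_consS n (z : measurableTypeR R * Rn R n) i :
  tnth (Rn_cons z) (lift ord0 i) = tnth z.2 i.
Proof. by rewrite /Rn_cons tnthS. Qed.

Lemma leb_consE n (f : Rn R n.+1 -> \bar R) :
  measurable_fun [set: Rn R n.+1] f ->
  (@lebesgue_measure R \x leb R n)%E.-integrable setT (f \o @Rn_cons R n) ->
  (leb R n.+1).-integrable setT f /\
  (\int[leb R n.+1]_x f x =
   \int[(@lebesgue_measure R \x leb R n)%E]_z f (Rn_cons z))%E.
Proof.
move=> mf If; have mc := @measurable_Rn_cons R n.
split; last exact: (integral_pushforward mc mf If measurableT).
exact: (integrable_pushforward mc mf If measurableT).
Qed.

(** Induction on the dimension, since the measure of R^(n+1) is the image of a
    product measure. *)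
Lemma integrable_prod n (f : 'I_n -> R -> R) :
  (forall i, (@lebesgue_measure R).-integrable setT (EFin \o f i)) ->
  (leb R n).-integrable setT (fun x => (\prod_(i < n) f i (tnth x i))%:E) /\
  ((exists j, \int[@lebesgue_measure R]_t (f j t)%:E = 0) ->
    \int[leb R n]_x (\prod_(i < n) f i (tnth x i))%:E = 0)%E.
Proof.
elim: n f => [|n IHn] f intf.
  split; last by case=> -[].
  rewrite (_ : (fun _ => _) = cst (1%:E)); last by apply/funext => x; rewrite big_ord0.
  apply/integrableP; split => //=.
  by rewrite integral_dirac//= diracT mul1e normr1 ltry.
have [intg g0] := IHn (fun i => f (lift ord0 i)) (fun i => intf _).
set F := fun x : Rn R n.+1 => _.
have FE : F \o @Rn_cons R n = fun z => (f ord0 z.1 *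
    \prod_(i < n) f (lift ord0 i) (tnth z.2 i))%:E.
  apply/funext => z; rewrite /F /= big_ord_recl tnth_cons0; congr (_ * _)%:E.
  by apply: eq_bigr => i _; rewrite tnth_consS.
have mF : measurable_fun [set: Rn R n.+1] F.
  apply/measurable_EFinP; apply: measurable_prod => i _.
  apply: (@measurableT_comp _ _ _ _ _ _ (f i)); last exact: measurable_tnth.
  by have /integrableP[/measurable_EFinP] := intf i.
have IF : (@lebesgue_measure R \x leb R n)%E.-integrable setT (F \o @Rn_cons R n).
  by rewrite FE; exact: (integrable_tensor (intf ord0) intg).
have [IF' eqF] := leb_consE mF IF; split => // -[j fj0].
rewrite eqF (_ : (fun z => _) = F \o @Rn_cons R n)// FE.
rewrite (integral_tensor (intf ord0) intg).
have [j' je|je] := unliftP ord0 j; last by rewrite -je fj0 mul0e.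
by rewrite g0 ?mule0//; exists j'; rewrite -je.
Qed.

Lemma bounded_integrable d (T : measurableType d) (mu : {measure set T -> \bar R})
    (E : set T) (M : R) (f : T -> R) :
  measurable E -> (mu E < +oo)%E -> measurable_fun [set: T] f ->
  (forall x, `|f x| <= M * \1_E x) -> mu.-integrable setT (EFin \o f).
Proof.
move=> mE Efin mf fM.
apply: (@le_integrable _ _ _ _ _ measurableT _ (fun x => (M%:E * (\1_E x)%:E)%E)).
- exact/measurable_EFinP.
- by move=> x _; rewrite -EFinM !abse_EFin lee_fin (le_trans (fM x))// ler_norm.
- apply: integrableZl => //; apply/integrableP; split.
    exact/measurable_EFinP/measurable_indic.
  under eq_integral do rewrite gee0_abs ?lee_fin//.
  by rewrite integral_indic// setIT.
Qed.

End product_functions.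

Section haar_functions.
Context (R : realType).

(** A one-dimensional Haar function without its normalization: for fixed [t], a
    character of the group of signatures, which makes products of Haar functions on the same cube
    again Haar functions ([haar_signM]). *)
Definition side_sign (a l t : R) (e : bool) : R :=
  if a <= t < a + l / 2 then 1 else if a + l / 2 <= t < a + l then (-1) ^+ e else 0.

Lemma haar1E (a l t : R) e : 0 < l -> haar1 a l e t = (Num.sqrt l)^-1 * side_sign a l t e.
Proof.
move=> l0; rewrite /haar1 /side_sign; congr (_ * _).
rewrite !indicE /= !mem_setE !in_itv /=.
have [h1|h1] := leP a t; have [h2|h2] := ltP t (a + l / 2);
  have [h3|h3] := ltP t (a + l); case: e => /=; rewrite ?expr1 ?expr0; try lra.
Qed.

Lemma side_signM (a l t : R) e e' :
  side_sign a l t e * side_sign a l t e' = side_sign a l t (e (+) e').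
Proof.
rewrite /side_sign; case: ifP => _; first by rewrite mulr1.
by case: ifP => _; rewrite ?mul0r// signr_addb.
Qed.

Lemma side_sign_norm (a l t : R) e : 0 < l ->
  `|side_sign a l t e| = \1_(`[a, a + l[%classic : set R) t.
Proof.
move=> l0; rewrite /side_sign indicE mem_setE in_itv/=.
case: ifPn => h1; first by rewrite normr1 (_ : _ && _)//; lra.
case: ifPn => h2; first by rewrite normr_sign (_ : _ && _)//; lra.
by rewrite normr0 (_ : _ && _ = false)//; apply/negbTE; lra.
Qed.

Lemma integrable_haar1 (a l : R) e :
  (@lebesgue_measure R).-integrable setT (EFin \o (fun t : R => @haar1 R a l e t)).
Proof.
have H b : (@lebesgue_measure R).-integrable setT
    (fun t => ((Num.sqrt l)^-1 * \1_(`[b, b + l / 2[%classic : set R) t)%:E).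
  under eq_fun do rewrite EFinM.
  by apply: integrableZl => //; exact: integrable_indic_itv.
have H' : (@lebesgue_measure R).-integrable setT
    (fun t => ((Num.sqrt l)^-1 * \1_(`[a, a + l[%classic : set R) t)%:E).
  under eq_fun do rewrite EFinM.
  by apply: integrableZl => //; exact: integrable_indic_itv.
case: e; last exact: H'.
rewrite (_ : EFin \o _ = (fun t => ((Num.sqrt l)^-1 * \1_(`[a, a + l / 2[%classic : set R) t)%:E)
  \- (fun t => ((Num.sqrt l)^-1 * \1_(`[a + l / 2, a + l / 2 + l / 2[%classic : set R) t)%:E))%E.
  by apply: integrableB.
by apply/funext => t; rewrite /= -EFinB /haar1 -mulrBr -addrA -splitr.
Qed.

Lemma integral_haar1 (a l : R) : 0 < l ->
  (\int[@lebesgue_measure R]_t (@haar1 R a l true t)%:E = 0)%E.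
Proof.
move=> l0; rewrite /haar1.
under eq_integral do rewrite EFinM EFinB.
rewrite integralZl//; last by apply: integrableB => //; exact: integrable_indic_itv.
rewrite integralB//; [|exact: integrable_indic_itv|exact: integrable_indic_itv].
rewrite !integral_indic// !setIT /= !lebesgue_measure_itv/= !lte_fin.
rewrite !ifT; [|lra|lra].
by rewrite -!EFinB (_ : _ - _ - _ = 0) ?mule0//; lra.
Qed.

End haar_functions.

Section cube_haar.
Context (R : realType) (n : nat).
Local Notation X := (Rn R n).
Implicit Types (I : cube R n) (eta : {ffun 'I_n -> bool}) (x : X).

Definition haar_sign I eta x : R :=
  \prod_(i < n) side_sign (tnth I.1 i) (side I) (tnth x i) (eta i).

Definition ffun_addb eta eta' : {ffun 'I_n -> bool} := [ffun i => eta i (+) eta' i].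

Lemma side_gt0 I : 0 < side I. Proof. by rewrite /side. Qed.

Lemma vol_gt0 I : 0 < vol I. Proof. by rewrite exprn_gt0// side_gt0. Qed.

Lemma sqrt_vol_gt0 I : 0 < Num.sqrt (vol I).
Proof. by rewrite sqrtr_gt0 vol_gt0. Qed.

Lemma sqrt_vol_sqr I : Num.sqrt (vol I) * Num.sqrt (vol I) = vol I.
Proof. by rewrite -expr2 sqr_sqrtr// ltW// vol_gt0. Qed.

Lemma indic_cset I x :
  \1_(cset I) x = \prod_(i < n)
    \1_(`[tnth I.1 i, tnth I.1 i + side I[%classic : set R) (tnth x i) :> R.
Proof.
rewrite indicE; case: (boolP (x \in _)) => [/set_mem Ix|Ix].
  rewrite big1// => i _; rewrite indicE mem_setE in_itv/=.
  by have /= -> := Ix i.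
have : ~ cset I x by move=> /mem_set; rewrite (negbTE Ix).
move=> /existsNP[i Iix]; rewrite (bigD1 i)//= indicE mem_setE in_itv/=.
by move/negP : Iix => /negbTE ->; rewrite mul0r.
Qed.

Lemma haarE I eta x : haar I eta x = (Num.sqrt (vol I))^-1 * haar_sign I eta x.
Proof.
rewrite /haar (eq_bigr (fun i => (Num.sqrt (side I))^-1 *
  side_sign (tnth I.1 i) (side I) (tnth x i) (eta i))); last first.
  by move=> i _; rewrite haar1E// side_gt0.
rewrite big_split/=; congr (_ * _); rewrite prodr_const card_ord exprVn; congr (_^-1).
rewrite /vol; move: (side I) (side_gt0 I) => l l0.
elim: (n) => [|m IH]; first by rewrite !expr0 sqrtr1.
by rewrite !exprS sqrtrM ?IH// ltW.
Qed.

Lemma haar_signM I eta eta' x :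
  haar_sign I eta x * haar_sign I eta' x = haar_sign I (ffun_addb eta eta') x.
Proof.
by rewrite -big_split/=; apply: eq_bigr => i _; rewrite side_signM ffunE.
Qed.

Lemma haar_sign_norm I eta x : `|haar_sign I eta x| = \1_(cset I) x.
Proof.
rewrite normr_prod indic_cset; apply: eq_bigr => i _.
by rewrite side_sign_norm// side_gt0.
Qed.

Lemma haar_sign0 I x : haar_sign I eta0 x = \1_(cset I) x.
Proof.
rewrite -(haar_sign_norm I eta0) ger0_norm//; apply: prodr_ge0 => i _.
by rewrite ffunE /side_sign expr0; case: ifP => // _; case: ifP.
Qed.

Lemma haar_norm I eta x : `|haar I eta x| = (Num.sqrt (vol I))^-1 * \1_(cset I) x.
Proof.
by rewrite haarE normrM haar_sign_norm gtr0_norm// invr_gt0 sqrt_vol_gt0.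
Qed.

Lemma haar_out I eta x : ~ cset I x -> haar I eta x = 0.
Proof.
move=> Ix; apply/eqP; rewrite -normr_eq0 haar_norm indicE.
by case: (boolP (x \in _)) => [/set_mem//|_]; rewrite mulr0.
Qed.

Lemma haarM I eta eta' x :
  haar I eta x * haar I eta' x = (Num.sqrt (vol I))^-1 * haar I (ffun_addb eta eta') x.
Proof. by rewrite !haarE mulrACA haar_signM -!mulrA. Qed.

Lemma integrable_haar I eta : (leb R n).-integrable setT (EFin \o haar I eta).
Proof.
have [+ _] := integrable_prod (fun i => integrable_haar1 (tnth I.1 i) (side I) (eta i)).
by [].
Qed.

Lemma measurable_haar I eta : measurable_fun [set: X] (haar I eta).
Proof. by have /integrableP[/measurable_EFinP] := integrable_haar I eta. Qed.

Lemma integral_haar I eta : eta != eta0 ->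
  (\int[leb R n]_x (haar I eta x)%:E = 0)%E.
Proof.
move=> eta_neq0.
have [_] := integrable_prod (fun i => integrable_haar1 (tnth I.1 i) (side I) (eta i)).
apply; apply: contrapT => /forallNP H; move/eqP : eta_neq0; apply.
apply/ffunP => i; rewrite ffunE; apply/negP => ei; apply: (H i).
by rewrite ei integral_haar1// side_gt0.
Qed.

Lemma integral_haar0 I : (\int[leb R n]_x (haar I eta0 x)%:E = (Num.sqrt (vol I))%:E)%E.
Proof.
under eq_integral do rewrite haarE haar_sign0 EFinM.
have mI := measurable_cset I.
rewrite ge0_integralZl ?lee_fin ?invr_ge0 ?sqrtr_ge0//; last first.
  exact/measurable_EFinP/measurable_indic.
rewrite integral_indic// setIT [X in (_ * X)%E]leb_cset -EFinM -{2}sqrt_vol_sqr mulKf//.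
by rewrite gt_eqF// sqrt_vol_gt0.
Qed.

Lemma atom_haar I eta : eta != eta0 ->
  atom I (fun x => Num.sqrt (vol I) * haar I eta x).
Proof.
move=> eta_neq0; split.
- by apply: measurable_funM => //; exact: measurable_haar.
- by move=> x Ix; rewrite haar_out ?mulr0.
- under eq_integral do rewrite EFinM.
  by rewrite integralZl ?integral_haar ?mule0//; exact: integrable_haar.
- rewrite unlock; case: ifP => // _; apply/ess_sup_inf.ess_supP; apply: aeW => x.
  rewrite /= lee_fin normrM haar_norm gtr0_norm ?sqrt_vol_gt0// mulVKf.
    by rewrite indicE lern1 leq_b1.
  by rewrite gt_eqF// sqrt_vol_gt0.
Qed.

End cube_haar.

(** * Dyadic cubes and orthonormality *)

Section dyadic_cubes.
Context (R : realType) (n : nat).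
Local Notation X := (Rn R n).
Implicit Types (I J : cube R n) (x : X) (D : set (cube R n)).

Definition subst_coord x (i : 'I_n) (t : R) : X := [tuple if j == i then t else tnth x j | j < n].

Lemma subst_coordE x i t j : tnth (subst_coord x i t) j = if j == i then t else tnth x j.
Proof. by rewrite tnth_mktuple. Qed.

Lemma cset_corner I : cset I I.1.
Proof. by move=> i; rewrite lexx ltrDl side_gt0. Qed.

(** The upper inequality is tested on points of [I] moved along one coordinate
    axis, since the upper face does not belong to the half-open cube. *)
Lemma cset_sub I J : cset I `<=` cset J -> forall i,
  tnth J.1 i <= tnth I.1 i /\ tnth I.1 i + side I <= tnth J.1 i + side J.
Proof.
move=> IJ i; have /(_ i)/andP[h1 h2] := IJ _ (cset_corner I); split=> //.
rewrite leNgt; apply/negP => h3.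
have /IJ/(_ i) : cset I (subst_coord I.1 i (Num.max (tnth I.1 i) (tnth J.1 i + side J))).
  move=> j; rewrite subst_coordE; case: eqP => [->|_]; last exact: cset_corner.
  by rewrite le_max lexx/= gt_max h3 ltrDl side_gt0.
by rewrite subst_coordE eqxx gt_max ltxx !andbF.
Qed.

Lemma cset_sub_side I J : (0 < n)%N -> cset I `<=` cset J -> side I <= side J.
Proof. by move=> n0 /cset_sub/(_ (Ordinal n0))[]; lra. Qed.

Lemma cube_eq I J : side I = side J -> (forall i, tnth I.1 i = tnth J.1 i) -> I = J.
Proof.
case: I J => [a l] [b m]; rewrite /side /= => lm ab.
by congr pair; [exact: eq_from_tnth|exact: val_inj].
Qed.

Lemma dyadic_eq D I J x : dyadic_grid D -> D I -> D J -> side I = side J ->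
  cset I x -> cset J x -> I = J.
Proof.
move=> [_ _ nested] DI DJ s Ix Jx; apply: cube_eq => // i.
have [/cset_sub/(_ i)|/cset_sub/(_ i)|IJ] := nested I J DI DJ; [lra|lra|].
by have : (cset I `&` cset J) x by []; rewrite IJ.
Qed.

Lemma dyadic_sub D I J x : dyadic_grid D -> D I -> D J -> (0 < n)%N ->
  side I <= side J -> cset I x -> cset J x -> cset I `<=` cset J.
Proof.
move=> gD DI DJ n0 s Ix Jx; have [_ _ nested] := gD.
have [//|JI|IJ] := nested I J DI DJ.
  have := cset_sub_side n0 JI => s'.
  by rewrite (@dyadic_eq D I J x)//; apply/eqP; rewrite eq_le s.
by have : (cset I `&` cset J) x by []; rewrite IJ.
Qed.

(** The cubes of half the side of [J] are not given as its children, only as a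
    partition of the space nested with [J].  If one of them, [H], started strictly
    between the lower face and the middle of [J] in direction [i], the cube of the
    same size through the projection of its corner to the lower face of [J] would
    meet [H] without being equal to it. *)
Lemma dyadic_half D I J i : dyadic_grid D -> D I -> D J ->
  side I < side J -> cset I `<=` cset J ->
  tnth I.1 i + side I <= tnth J.1 i + side J / 2 \/
  tnth J.1 i + side J / 2 <= tnth I.1 i.
Proof.
move=> gD DI DJ sIJ IJ; have n0 : (0 < n)%N := leq_ltn_trans (leq0n i) (ltn_ord i).
have [pow cover _] := gD.
have [k Ik] := pow _ DI; have [m Jm] := pow _ DJ.
have km : (k <= m - 1)%R.
  have : (2 : R) ^ k < 2 ^ m by rewrite -Ik -Jm.
  by rewrite ltr_eXz2l ?ltr1n// lerBrDr lezD1.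
have half : (2 : R) ^ (m - 1) = side J / 2.
  by rewrite Jm expfzDr ?pnatr_eq0// exprN1.
(* H is the cube of half the side of J that contains I. *)
have [H [DH Hm Hc]] := cover (m - 1) I.1; rewrite half in Hm.
have sIH : side I <= side H by rewrite Hm -half Ik ler_eXz2l ?ltr1n.
have IH := dyadic_sub gD DI DH n0 sIH (cset_corner I) Hc.
have J0 := side_gt0 J.
have HJ : cset H `<=` cset J.
  by apply: (dyadic_sub gD DH DJ n0 _ Hc (IJ _ (cset_corner I))); lra.
have [h1 h2] := cset_sub IH i; have [h3 h4] := cset_sub HJ i.
have [h5|h5] := leP (tnth J.1 i + side J / 2) (tnth H.1 i); first by right; lra.
left; suff : tnth H.1 i = tnth J.1 i by lra.
pose x := subst_coord H.1 i (tnth J.1 i).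
have xJ : cset J x.
  move=> j; rewrite subst_coordE; case: eqP => [->|_]; first by rewrite lexx ltrDl.
  exact: (HJ _ (cset_corner H)).
have [H' [DH' Hm' Hx']] := cover (m - 1) x; rewrite half in Hm'.
have H'J : cset H' `<=` cset J.
  by apply: (dyadic_sub gD DH' DJ n0 _ Hx' xJ); lra.
have [h6 _] := cset_sub H'J i.
have := Hx' i; rewrite subst_coordE eqxx => h7.
have -> : H = H'.
  apply: (dyadic_eq gD DH DH' _ (cset_corner H)); first by rewrite Hm.
  move=> j; have := Hx' j; rewrite subst_coordE; case: eqP => [->|//]; lra.
lra.
Qed.

Lemma haar_const D I J eta x y : dyadic_grid D -> D I -> D J ->
  side I < side J -> cset I `<=` cset J -> cset I x -> cset I y ->
  haar J eta x = haar J eta y.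
Proof.
move=> gD DI DJ sIJ IJ Ix Iy; apply: eq_bigr => i _.
rewrite !haar1E ?side_gt0//; congr (_ * _).
have [h1 h2] := cset_sub IJ i; have := dyadic_half i gD DI DJ sIJ IJ.
move: (Ix i) (Iy i) h1 h2; move: (tnth x i) (tnth y i) => t t'.
move: (tnth J.1 i) (side J) (tnth I.1 i) (side I) => a l b m ht ht' h1 h2 [h|h].
  have left_half u : b <= u < b + m -> a <= u < a + l / 2 by lra.
  by rewrite /side_sign !left_half.
have not_left u : b <= u < b + m -> (a <= u < a + l / 2) = false.
  by move=> ?; apply/negbTE; lra.
have right_half u : b <= u < b + m -> a + l / 2 <= u < a + l by lra.
by rewrite /side_sign !not_left// !right_half.
Qed.

Lemma haar_mul_integrable I J eta eta' :
  (leb R n).-integrable setT (fun x => (haar I eta x * haar J eta' x)%:E).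
Proof.
apply: (@bounded_integrable _ _ _ _ (cset I)
  ((Num.sqrt (vol I))^-1 * (Num.sqrt (vol J))^-1)).
- exact: measurable_cset.
- by rewrite [X in (X < _)%E]leb_cset ltry.
- by apply: measurable_funM; exact: measurable_haar.
- move=> x; rewrite normrM !haar_norm mulrACA.
  apply: ler_wpM2l; first by rewrite mulr_ge0 ?invr_ge0 ?sqrtr_ge0.
  by apply: ler_piMr => //; rewrite indicE lern1 leq_b1.
Qed.

Lemma ffun_addb_eq0 (eta eta' : {ffun 'I_n -> bool}) :
  (ffun_addb eta eta' == eta0) = (eta == eta').
Proof.
apply/eqP/eqP => [/ffunP H|->]; apply/ffunP => i.
  by have := H i; rewrite !ffunE; case: (eta i); case: (eta' i).
by rewrite !ffunE addbb.
Qed.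

Lemma haar_orthonormal I eta eta' :
  (\int[leb R n]_x (haar I eta x * haar I eta' x)%:E = (eta == eta')%:R%:E)%E.
Proof.
under eq_integral do rewrite haarM EFinM.
rewrite integralZl//; last exact: integrable_haar.
rewrite -ffun_addb_eq0; case: eqP => [->|/eqP ne]; last by rewrite integral_haar// mule0.
by rewrite integral_haar0 -EFinM mulVf// gt_eqF// sqrt_vol_gt0.
Qed.

Lemma haar_mul0 D I J eta eta' x : dyadic_grid D -> D I -> D J ->
  side I = side J -> I <> J -> haar I eta x * haar J eta' x = 0.
Proof.
move=> gD DI DJ sIJ IJ.
have [Ix|/haar_out ->] := pselect (cset I x); last by rewrite mul0r.
have [Jx|/haar_out ->] := pselect (cset J x); last by rewrite mulr0.
by case: IJ; exact: (dyadic_eq gD DI DJ sIJ Ix Jx).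
Qed.

(** On the smaller cube the other function is constant, and the mean vanishes. *)
Lemma haar_orthogonal D I J eta eta' : dyadic_grid D -> D I -> D J -> (0 < n)%N ->
  side I < side J -> eta != eta0 ->
  (\int[leb R n]_x (haar I eta x * haar J eta' x)%:E = 0)%E.
Proof.
move=> gD DI DJ n0 sIJ eta_neq0.
have [[x [Ix Jx]]|/forallNP IJ] := pselect (exists x, cset I x /\ cset J x).
  have sub := dyadic_sub gD DI DJ n0 (ltW sIJ) Ix Jx.
  rewrite (eq_integral (fun y => (haar J eta' x)%:E * (haar I eta y)%:E)%E).
    by rewrite integralZl ?integral_haar ?mule0//; exact: integrable_haar.
  move=> y _; rewrite -EFinM; congr EFin.
  have [Iy|/haar_out ->] := pselect (cset I y); last by rewrite mul0r mulr0.
  by rewrite mulrC (haar_const _ gD DI DJ sIJ sub Ix Iy).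
rewrite integral0_eq// => y _.
have [Iy|/haar_out ->] := pselect (cset I y); last by rewrite mul0r.
have [Jy|/haar_out ->] := pselect (cset J y); last by rewrite mulr0.
by case: (IJ y).
Qed.

End dyadic_cubes.

Section rect_haar.
Context (R : realType) (d1 d2 : nat).
Local Notation Rd := (Rn R d1 * Rn R d2)%type.
Local Notation idx := (rect R d1 d2 * {ffun 'I_d2 -> bool})%type.

Definition rect_haar (p : idx) : Rd -> R := tensor (haar p.1.1 eta0) (haar p.1.2 p.2).

Lemma integrable_rect_haarM (p q : idx) :
  (leb2 R d1 d2).-integrable setT (fun x => (rect_haar p x * rect_haar q x)%:E).
Proof.
have := integrable_tensor (haar_mul_integrable p.1.1 q.1.1 eta0 eta0)
   (haar_mul_integrable p.1.2 q.1.2 p.2 q.2).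
by apply: eq_integrable => // x _; rewrite /rect_haar /tensor mulrACA.
Qed.

Lemma integral_rect_haarM (p q : idx) :
  (\int[leb2 R d1 d2]_x (rect_haar p x * rect_haar q x)%:E =
   \int[leb R d1]_x (haar p.1.1 eta0 x * haar q.1.1 eta0 x)%:E *
   \int[leb R d2]_x (haar p.1.2 p.2 x * haar q.1.2 q.2 x)%:E)%E.
Proof.
rewrite -(integral_tensor (haar_mul_integrable p.1.1 q.1.1 eta0 eta0)
   (haar_mul_integrable p.1.2 q.1.2 p.2 q.2)).
by apply: eq_integral => x _; rewrite /rect_haar /tensor mulrACA.
Qed.

(** The first factors are not cancellative, so orthogonality across scales comes
    from the second factors.  It is the equality of the two side lengths that
    makes the scales of both factors agree. *)
Lemma rect_haar_orthonormal D1 D2 (p q : idx) : (0 < d2)%N ->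
  dyadic_grid D1 -> dyadic_grid D2 ->
  diag_grid D1 D2 p.1 -> diag_grid D1 D2 q.1 -> p.2 != eta0 -> q.2 != eta0 ->
  (\int[leb2 R d1 d2]_x (rect_haar p x * rect_haar q x)%:E = (p == q)%:R%:E)%E.
Proof.
move=> d20 gD1 gD2 [Dp1 Dp2 cp] [Dq1 Dq2 cq] p0 q0.
rewrite integral_rect_haarM.
case: p q Dp1 Dp2 cp Dq1 Dq2 cq p0 q0 => [[I1 I2] eta] [[J1 J2] eta'] /=.
rewrite /is_cube /= => DI1 DI2 cI DJ1 DJ2 cJ p0 q0.
have [lt|lt|s2] := ltgtP (side I2) (side J2).
- rewrite (haar_orthogonal _ gD2 DI2 DJ2)// mule0; case: eqP => // -[_ IJ _].
  by rewrite IJ ltxx in lt.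
- under [X in (_ * X)%E]eq_integral do rewrite mulrC.
  rewrite (haar_orthogonal _ gD2 DJ2 DI2)// mule0; case: eqP => // -[_ IJ _].
  by rewrite IJ ltxx in lt.
have s1 : side I1 = side J1 by rewrite cI cJ.
have [IJ1|IJ1] := pselect (I1 = J1); last first.
  rewrite integral0_eq ?mul0e; last by move=> x _; rewrite (haar_mul0 _ _ _ gD1).
  by case: eqP => // -[].
have [IJ2|IJ2] := pselect (I2 = J2); last first.
  rewrite [X in (_ * X)%E]integral0_eq ?mule0; last by move=> x _; rewrite (haar_mul0 _ _ _ gD2).
  by case: eqP => // -[].
rewrite IJ1 IJ2 !haar_orthonormal eqxx mul1e; congr (_%:R%:E).
by rewrite xpair_eqE eqxx.
Qed.

End rect_haar.

(** * The local term: Bessel's inequality *)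

Section bessel.
Context (R : realType) (d1 d2 : nat) (T : flagSIO R d1 d2).
Local Notation Rd := (Rn R d1 * Rn R d2)%type.
Local Notation idx := (rect R d1 d2 * {ffun 'I_d2 -> bool})%type.

Lemma dom_zero : dom T (fun=> 0).
Proof.
pose I : rect R d1 d2 := (([tuple 0 | i < d1], PosNum ltr01), ([tuple 0 | i < d2], PosNum ltr01)).
have := dom_linear (-1) (dom_rect T I) (dom_rect T I).
by congr (dom T); apply/funext => x; rewrite mulN1r addNr.
Qed.

Lemma dom_scale c f : dom T f -> dom T (fun x => c * f x).
Proof.
move=> df; have := dom_linear c df dom_zero.
by congr (dom T); apply/funext => x; rewrite addr0.
Qed.

Lemma form_zero_r f : dom T f -> form T f (fun=> 0) = 0.
Proof.
move=> df; have := form_linear_r 1 df dom_zero dom_zero.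
rewrite (_ : (fun x : Rd => _) = (fun=> 0)); last by apply/funext => x; rewrite mulr0 addr0.
by lra.
Qed.

Lemma dom_rect_haar (p : idx) : p.2 != eta0 -> dom T (rect_haar p).
Proof.
move=> p0; have := dom_atom2 T p.1.1 (atom_haar p.1.2 p0).
move=> /(dom_scale ((Num.sqrt (vol p.1.1))^-1 * (Num.sqrt (vol p.1.2))^-1)).
have haar0E y : haar p.1.1 eta0 y = (Num.sqrt (vol p.1.1))^-1 * \1_(cset p.1.1) y.
  by rewrite haarE haar_sign0.
congr (dom T); apply/funext => x; rewrite /rect_haar /tensor haar0E /ind.
by field; rewrite !gt_eqF// sqrt_vol_gt0.
Qed.

Lemma form_sum_r f (s : seq idx) (c : idx -> R) : dom T f ->
  all (fun p => p.2 != eta0) s ->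
  dom T (fun x => \sum_(p <- s) c p * rect_haar p x) /\
  form T f (fun x => \sum_(p <- s) c p * rect_haar p x) =
    \sum_(p <- s) c p * form T f (rect_haar p).
Proof.
move=> df; elim: s => [_|p s IH /= /andP[p0 /IH[ds fs]]].
  rewrite big_nil (_ : (fun x : Rd => _) = (fun=> 0)); last first.
    by apply/funext => x; rewrite big_nil.
  by split; [exact: dom_zero|exact: form_zero_r].
have -> : (fun x => \sum_(p <- p :: s) c p * rect_haar p x) =
    (fun x => c p * rect_haar p x + \sum_(p <- s) c p * rect_haar p x).
  by apply/funext => x; rewrite big_cons.
have dp := dom_rect_haar p0.
by rewrite big_cons -fs -(form_linear_r _ df dp ds); split => //; exact: dom_linear.
Qed.

Lemma Lnorm2_sqr d (X : measurableType d) (mu : {measure set X -> \bar R})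
    (phi : X -> R) (C : R) :
  ('N[mu]_2[EFin \o phi] <= C%:E)%E ->
  (\int[mu]_x (phi x ^+ 2)%:E <= (C ^+ 2)%:E)%E.
Proof.
move=> NC; have C0 : 0 <= C by rewrite -lee_fin; apply: le_trans NC; exact: Lnorm_ge0.
have two0 : (2 : R) != 0 by rewrite pnatr_eq0.
have := poweR_Lnorm mu (EFin \o phi) two0.
rewrite (eq_integral (fun x => (phi x ^+ 2)%:E)) => [<-|x _]; last first.
  by rewrite /= powR_mulrn// real_normK// num_real.
rewrite -powR_mulrn// -poweR_EFin; apply: gt0_ler_poweR => //.
- by rewrite in_itv/= Lnorm_ge0 leey.
- by rewrite in_itv/= lee_fin C0 leey.
Qed.

(** Testing the form against g = sum of c_p h_p, with c_p = form(1_Q, h_p), gives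
    the sum of the c_p^2, while the integral of phi g is at most half of
    ||phi||^2 + ||g||^2, and ||g||^2 is again the sum of the c_p^2. *)
Lemma bessel_form D1 D2 (Q : rect R d1 d2) (phi : Rd -> R) (M : R) (s : seq idx) :
  (0 < d2)%N -> dyadic_grid D1 -> dyadic_grid D2 ->
  measurable_fun [set: Rd] phi ->
  (\int[leb2 R d1 d2]_x (phi x ^+ 2)%:E <= M%:E)%E ->
  (forall g, dom T g -> (forall x, ~ rset Q x -> g x = 0) ->
    (form T (rind Q) g)%:E = (\int[leb2 R d1 d2]_x (phi x * g x)%:E)%E) ->
  uniq s ->
  (forall p, p \in s -> [/\ diag_grid D1 D2 p.1, rset p.1 `<=` rset Q & p.2 != eta0]) ->
  \sum_(p <- s) form T (rind Q) (rect_haar p) ^+ 2 <= M.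
Proof.
move=> d20 gD1 gD2 mphi phiM test us sP.
pose c p := form T (rind Q) (rect_haar p).
pose g x := \sum_(p <- s) c p * rect_haar p x.
have s0 : all (fun p => p.2 != eta0) s by apply/allP => p /sP[].
have [dg fg] := form_sum_r c (dom_rect T Q) s0.
have gQ x : ~ rset Q x -> g x = 0.
  move=> Qx; rewrite /g big_seq big1// => p /sP[_ pQ _].
  have [h1|/haar_out h1] := pselect (cset p.1.1 x.1); last first.
    by rewrite /rect_haar /tensor h1 mul0r mulr0.
  have [h2|/haar_out h2] := pselect (cset p.1.2 x.2); last first.
    by rewrite /rect_haar /tensor h2 !mulr0.
  by case: Qx; apply: pQ.
have := test g dg gQ; rewrite [form _ _ _]fg.
under eq_bigr do rewrite -/(c _) -expr2.
set S := \sum_(p <- s) c p ^+ 2 => Sint.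
have mg : measurable_fun [set: Rd] g.
  apply: measurable_sum => p; apply: measurable_funM => //.
  apply: measurable_funM.
    exact: (measurableT_comp (measurable_haar _ _) measurable_fst).
  exact: (measurableT_comp (measurable_haar _ _) measurable_snd).
have g2 : (\int[leb2 R d1 d2]_x (g x ^+ 2)%:E = S%:E)%E.
  have Ipq p q : (leb2 R d1 d2).-integrable setT
      (fun x => (c p * c q)%:E * (rect_haar p x * rect_haar q x)%:E)%E.
    by apply: integrableZl => //; exact: integrable_rect_haarM.
  rewrite (eq_integral (fun x => \sum_(p <- s) \sum_(q <- s)
     (c p * c q)%:E * (rect_haar p x * rect_haar q x)%:E))%E; last first.
    move=> x _; rewrite expr2 /g mulr_suml -sumEFin; apply: eq_bigr => p _.
    rewrite mulr_sumr -sumEFin; apply: eq_bigr => q _.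
    by rewrite -EFinM mulrACA.
  rewrite integral_sum//; last by move=> p; exact: integrable_sum.
  rewrite /S -sumEFin big_seq [in RHS]big_seq; apply: eq_bigr => p ps.
  rewrite integral_sum// (eq_big_seq (fun q => if q == p then (c p ^+ 2)%:E else 0%E)).
    by rewrite (bigD1_seq p)//= eqxx big1 ?adde0// => q /negbTE ->.
  move=> q qs; have [pD _ p0] := sP _ ps; have [qD _ q0] := sP _ qs.
  rewrite integralZl//; last exact: integrable_rect_haarM.
  rewrite (rect_haar_orthonormal d20 gD1 gD2)// eq_sym.
  by case: eqP => [->|_]; rewrite ?mule1 ?mule0// expr2.
(* phi g <= (phi^2 + g^2) / 2 *)
have h : (`|S%:E| <= (2^-1)%:E * \int[leb2 R d1 d2]_x (phi x ^+ 2)%:E +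
                    (2^-1)%:E * \int[leb2 R d1 d2]_x (g x ^+ 2)%:E)%E.
  have m2 (f : Rd -> R) : measurable_fun [set: Rd] f ->
      measurable_fun [set: Rd] (fun x => (f x ^+ 2)%:E).
    by move=> mf; apply/measurable_EFinP; exact: measurable_funX.
  rewrite -!ge0_integralZl ?lee_fin//; [|exact: m2|by move=> x _; rewrite lee_fin sqr_ge0
    |exact: m2|by move=> x _; rewrite lee_fin sqr_ge0].
  rewrite -ge0_integralD//.
  - rewrite Sint; apply: abse_integral_le => x.
    rewrite -!EFinM -EFinD lee_fin ler_norml.
    have := sqr_ge0 (phi x + g x); have := sqr_ge0 (phi x - g x).
    by rewrite sqrrB sqrrD; lra.
  - by move=> x _; rewrite mule_ge0// lee_fin sqr_ge0.
  - by apply: measurable_funeM; exact: m2.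
  - by move=> x _; rewrite mule_ge0// lee_fin sqr_ge0.
  - by apply: measurable_funeM; exact: m2.
have {h} : (S%:E <= (2^-1 * M + 2^-1 * S)%:E)%E.
  apply: le_trans (le_trans h _); first by rewrite lee_fin ler_norm.
  by rewrite g2 EFinD !EFinM; apply: leeD => //; apply: lee_wpmul2l.
by rewrite lee_fin; lra.
Qed.

End bessel.

(** * Pointwise kernel bounds and the gain from smoothness *)

Section kernel_bounds.
Context (R : realType).

Lemma sum_powerset1 (P : finType) (a : P) (f : {set P} -> R) :
  \sum_(B in powerset [set a]%SET) f B = f [set a]%SET + f finset.set0.
Proof.
have -> : powerset [set a]%SET = ([set a] |: [set finset.set0])%SET.
  by apply/setP => B; rewrite !inE subset1.
rewrite big_setU1/= ?big_set1// !inE; apply/eqP => /setP/(_ a).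
by rewrite !inE eqxx.
Qed.

(** The kernel estimate with no increment. *)
Lemma partial_kernel_size n (alpha C : R) (S F : Rn R n -> Rn R n -> R) x y :
  is_partial_kernel alpha C S F -> 0 <= S x y -> x <> y ->
  `|F x y| <= `|C| * S x y.
Proof.
move=> H S0 xy; apply: le_trans (ler_wpM2r S0 (ler_norm C)).
have := H finset.set0 finset.set0 (fun=> x) (fun=> y) (fun=> x) xy.
rewrite powerset0 big_set1 big_set0 finset.setDv cards0 expr0 mul1r mulr1 /mix !inE.
by apply=> i; rewrite inE.
Qed.

Lemma partial_kernel_holder n (alpha C : R) (S F : Rn R n -> Rn R n -> R) x y c :
  is_partial_kernel alpha C S F -> 0 <= S x y -> x <> y ->
  edist c x <= edist x y / 2 ->
  `|F x y - F c y| <= `|C| * (edist c x / edist x y) `^ alpha * S x y.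
Proof.
move=> H S0 xy xc.
apply: (@le_trans _ _ (C * (edist c x / edist x y) `^ alpha * S x y)); last first.
  by rewrite ler_wpM2r// ler_wpM2r ?powR_ge0// ler_norm.
have := H finset.set0 [set tt]%SET (fun=> x) (fun=> y) (fun=> c) xy.
rewrite sum_powerset1 big_set1 finset.setDv cards0 expr0 mul1r finset.setD0 cards1 expr1.
rewrite /mix !inE mulN1r distrC => -> //.
Qed.

Context (d1 d2 : nat).
Local Notation Rd := (Rn R d1 * Rn R d2)%type.

Lemma sizeF_ge0 (x y : Rd) : 0 <= sizeF x y.
Proof.
by rewrite mulr_ge0// invr_ge0 exprn_ge0// ?addr_ge0 ?edist_ge0.
Qed.

Lemma full_kernel_size (a1 a2 C : R) (F : Rd -> Rd -> R) x y :
  is_full_kernel a1 a2 C F -> x.1 <> y.1 -> `|F x y| <= `|C| * sizeF x y.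
Proof.
pose pt (x : Rd) := fun i => if i return Rn R (dim2 d1 d2 i) then x.2 else x.1.
move=> H xy; apply: le_trans (ler_wpM2r (sizeF_ge0 x y) (ler_norm C)).
have := H finset.set0 finset.set0 (pt x) (pt y) (pt x) xy.
rewrite powerset0 big_set1 big_set0 finset.setDv cards0 expr0 mul1r mulr1 /mix !inE /pt.
rewrite -!surjective_pairing.
by apply=> i; rewrite inE.
Qed.

(** The kernel estimate with a single increment, in the second parameter. *)
Lemma full_kernel_holder (a1 a2 C : R) (F : Rd -> Rd -> R) x y c :
  is_full_kernel a1 a2 C F -> x.1 <> y.1 -> edist c x.2 <= edist x.2 y.2 / 2 ->
  `|F x y - F (x.1, c) y| <= `|C| * (edist c x.2 / edist x.2 y.2) `^ a2 * sizeF x y.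
Proof.
pose pt (x : Rd) := fun i => if i return Rn R (dim2 d1 d2 i) then x.2 else x.1.
move=> H xy xc.
apply: (@le_trans _ _ (C * (edist c x.2 / edist x.2 y.2) `^ a2 * sizeF x y)); last first.
  by rewrite ler_wpM2r ?sizeF_ge0// ler_wpM2r ?powR_ge0// ler_norm.
have := H finset.set0 [set true]%SET (pt x) (pt y) (pt (x.1, c)) xy.
rewrite sum_powerset1 big_set1 finset.setDv cards0 expr0 mul1r finset.setD0 cards1 expr1.
rewrite /mix !inE /= /pt -!surjective_pairing mulN1r distrC; apply.
by move=> i; rewrite inE => /eqP ->.
Qed.

End kernel_bounds.

Section cube_geometry.
Context (R : realType) (n : nat).
Implicit Types (I Q : cube R n) (x y : Rn R n).

Lemma triple_far Q x y : cset Q x -> ~ cset (triple Q) y -> side Q <= edist x y.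
Proof.
move=> Qx /existsNP[i yi]; apply: le_trans (coord_le_edist x y i).
rewrite leNgt ltr_norml; apply/negP => h; apply: yi.
have := Qx i; move: h; rewrite /triple /= tnth_mktuple /side /=; lra.
Qed.

Lemma triple_near Q x y : cset Q x -> cset (triple Q) y ->
  edist x y <= n%:R * (2 * side Q).
Proof.
move=> Qx Qy; have s0 := side_gt0 Q; apply: edist_le; first by lra.
move=> i; rewrite ler_norml; have := Qx i; have := Qy i; move: s0.
by rewrite /triple /= tnth_mktuple /side /=; lra.
Qed.

Lemma center_in I : cset I (center I).
Proof.
by move=> i; rewrite /center tnth_mktuple; have := side_gt0 I; lra.
Qed.

Lemma center_near I x : cset I x -> edist (center I) x <= n%:R * side I.
Proof.
move=> Ix; have s0 := side_gt0 I; apply: edist_le; first by lra.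
move=> i; rewrite ler_norml /center tnth_mktuple; have := Ix i; lra.
Qed.

Lemma side_triple Q : side (triple Q) = 3 * side Q. Proof. by []. Qed.

Lemma vol_triple Q : vol (triple Q) = 3 ^+ n * vol Q.
Proof. by rewrite /vol side_triple exprMn. Qed.

Lemma triple_sup Q : cset Q `<=` cset (triple Q).
Proof.
move=> x Qx i; have := Qx i; have := side_gt0 Q.
by rewrite /triple /= tnth_mktuple /side /=; lra.
Qed.

End cube_geometry.

Section smoothness_gain.
Context (R : realType).

(** Factor 2n: the Hoelder gain is missing only if |x - y| < 2n l, where the
    claimed gain (l / |x - y|)^alpha is at least 1/(2n).  Factor 1 + (2n)^n: there
    two size bounds are added, and replacing x by the center shrinks the distance
    by a factor at most 2n. *)
Definition gain_const (n : nat) : R := 2 * n%:R * (1 + (2 * n%:R) ^+ n).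

(** The gain holds without the proviso rho <= b / 2 of the kernel estimate: when it
    fails, b is comparable to l and the size estimate suffices.  Here [b] and [b']
    are the distances from x_2 and from the center to y_2, [rho] is the distance
    from x_2 to the center, and [a] is the distance in the first parameter. *)
Lemma far_gain (k k' C W a b b' rho l alpha : R) n : (0 < n)%N ->
  0 < l -> 0 <= a -> rho <= n%:R * l -> 0 <= rho -> l <= b -> l <= b' ->
  0 < alpha <= 1 -> 0 <= C -> 0 <= W ->
  `|k| <= C * (W * ((a + b) ^+ n)^-1) -> `|k'| <= C * (W * ((a + b') ^+ n)^-1) ->
  (rho <= b / 2 -> `|k - k'| <= C * (rho / b) `^ alpha * (W * ((a + b) ^+ n)^-1)) ->
  `|k - k'| <= C * gain_const n * ((l / b) `^ alpha * (W * ((a + b) ^+ n)^-1)).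
Proof.
move=> n0 l0 a0 rl r0 lb lb' /andP[al0 al1] C0 W0 hk hk' hkk.
have b0 : 0 < b by lra.
have ab0 : 0 < a + b by lra.
have n1 : (1 : R) <= n%:R by rewrite ler1n.
have lb0 : 0 < l / b by rewrite divr_gt0.
have [V VE] : exists V, W * ((a + b) ^+ n)^-1 = V by eexists.
rewrite VE in hk hkk *.
have V0 : 0 <= V by rewrite -VE mulr_ge0// invr_ge0 exprn_ge0// ltW.
have p0 : 0 <= (l / b) `^ alpha := powR_ge0 _ _.
have g0 : n%:R <= gain_const n.
  rewrite /gain_const; have : 0 <= (2 * n%:R : R) ^+ n by rewrite exprn_ge0 ?mulr_ge0.
  by move: (_ ^+ n) => t t0; nra.
have [rb|rb] := leP rho (b / 2).
  apply: le_trans (hkk rb) _; rewrite -mulrA -[leRHS]mulrA.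
  apply: ler_wpM2l => //.
  rewrite [leRHS]mulrA; apply: ler_wpM2r => //.
  apply: (@le_trans _ _ ((n%:R * (l / b)) `^ alpha)).
    apply: ge0_ler_powR; rewrite ?nnegrE ?(ltW al0)//.
    - by rewrite divr_ge0// ltW.
    - by rewrite mulr_ge0// ltW.
    - by rewrite mulrA ler_pM2r// invr_gt0.
  rewrite powRM//; last exact: ltW.
  apply: ler_wpM2r => //; apply: le_trans g0.
  by rewrite -[leRHS](powRr1 (ler0n _ n)); exact: ler_powR.
(* From here on b is comparable to l. *)
have bl : b <= 2 * n%:R * l by lra.
have nl0 : 0 < 2 * n%:R * l by lra.
have n20 : 0 < 2 * n%:R :> R by lra.
have hp : (2 * n%:R)^-1 <= (l / b) `^ alpha.
  apply: (@le_trans _ _ ((2 * n%:R)^-1 `^ alpha)).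
    apply: ger1_powR; rewrite // invr_gt0 n20/= invf_le1//; lra.
  apply: ge0_ler_powR; rewrite ?nnegrE ?(ltW al0) ?invr_ge0 ?(ltW n20) ?(ltW lb0)//.
  by rewrite ler_pdivlMr// mulrC ler_pdivrMr// mulrC.
have hV : W * ((a + b') ^+ n)^-1 <= (2 * n%:R) ^+ n * V.
  rewrite -VE mulrCA; apply: ler_wpM2l => //.
  have b'0 : 0 < a + b' by lra.
  rewrite -[(2 * _) ^+ n]invrK -invfM lef_pV2 ?posrE; last 2 first.
  - by rewrite exprn_gt0.
  - by rewrite mulr_gt0 ?invr_gt0 ?exprn_gt0.
  have key : a + b <= (a + b') * (2 * n%:R).
    have h1 : 0 <= (2 * n%:R - 1) * a by rewrite mulr_ge0//; lra.
    have h2 : 0 <= 2 * n%:R * (b' - l) by rewrite mulr_ge0//; lra.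
    lra.
  rewrite mulrC ler_pdivrMr ?exprn_gt0// -exprMn lerXn2r ?nnegrE ?(ltW ab0)//.
  by rewrite mulr_ge0// ltW.
apply: le_trans (ler_normB _ _) _; apply: le_trans (lerD hk hk') _.
rewrite -mulrDr -[leRHS]mulrA; apply: ler_wpM2l => //.
apply: (@le_trans _ _ ((1 + (2 * n%:R) ^+ n) * V)); first by rewrite mulrDl mul1r lerD2l.
rewrite /gain_const mulrA; apply: ler_wpM2r => //.
rewrite mulrAC; apply: ler_peMl; first by rewrite addr_ge0// exprn_ge0// ltW.
by rewrite -ler_pdivrMl// mulr1.
Qed.

(** Beyond the threshold distance 2n (l L)^{1/2} the Hoelder estimate gains
    (l / L)^{alpha/2}; below it nothing is gained, but that region has measure
    (l / L)^{n/2} L^n up to a constant. *)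
Lemma near_gain (k k' C W b rho l L alpha : R) n : (0 < n)%N ->
  0 < l -> l <= L -> rho <= n%:R * l -> 0 <= rho -> 0 <= b ->
  0 < alpha <= 1 -> 0 <= C -> 0 <= W ->
  `|k| <= C * W -> `|k'| <= C * W ->
  (rho <= b / 2 -> `|k - k'| <= C * (rho / b) `^ alpha * W) ->
  `|k - k'| <= 2 * C * (((l / L) `^ (alpha / 2) + (b < 2 * n%:R * Num.sqrt (l * L))%R%:R) * W).
Proof.
move=> n0 l0 lL rl r0 b0 /andP[al0 al1] C0 W0 hk hk' hkk.
have n1 : (1 : R) <= n%:R by rewrite ler1n.
have L0 : 0 < L by lra.
set s := Num.sqrt (l * L).
have s0 : 0 < s by rewrite sqrtr_gt0 mulr_gt0.
have ss : s * s = l * L by rewrite -expr2 sqr_sqrtr// mulr_ge0// ltW.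
have ls : l <= s.
  rewrite -[leLHS]ger0_norm ?(ltW l0)// -sqrtr_sqr.
  rewrite ler_sqrt ?mulr_ge0 ?(ltW l0) ?(ltW L0)//.
  by rewrite expr2 ler_wpM2l// ltW.
have p0 : 0 <= (l / L) `^ (alpha / 2) := powR_ge0 _ _.
have [bs|bs] := ltP b (2 * n%:R * s).
  apply: le_trans (ler_normB _ _) _; apply: le_trans (lerD hk hk') _.
  have : C * W <= C * (((l / L) `^ (alpha / 2) + true%:R) * W).
    by apply: ler_wpM2l => //; apply: ler_peMl => //=; lra.
  lra.
have rb : rho <= b / 2.
  by rewrite ler_pdivlMr//; apply: le_trans bs; nra.
have b'0 : 0 < b by apply: lt_le_trans bs; rewrite mulr_gt0//; lra.
apply: le_trans (hkk rb) _; rewrite addr0 -!mulrA.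
have hp : (rho / b) `^ alpha <= (l / L) `^ (alpha / 2).
  rewrite (_ : (l / L) `^ (alpha / 2) = (l / s) `^ alpha).
    apply: ge0_ler_powR; rewrite ?nnegrE ?(ltW al0)//.
    - by rewrite divr_ge0.
    - by rewrite divr_ge0 ?(ltW l0)// ltW.
    rewrite ler_pdivrMr// mulrAC ler_pdivlMr//.
    have : rho * s <= n%:R * l * s by rewrite ler_wpM2r// ltW.
    by nra.
  rewrite (mulrC alpha) powRrM powR12_sqrt ?divr_ge0 ?(ltW l0) ?(ltW L0)//; congr (_ `^ _).
  apply/eqP; rewrite -(@eqrXn2 _ 2) ?sqrtr_ge0 ?divr_ge0 ?(ltW l0) ?(ltW s0)//.
  rewrite sqr_sqrtr ?divr_ge0 ?(ltW l0) ?(ltW L0)// expr_div_n !expr2 ss.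
  by rewrite invfM mulrA mulfK// gt_eqF.
have h1 : C * ((rho / b) `^ alpha * W) <= C * ((l / L) `^ (alpha / 2) * W).
  by apply: ler_wpM2l => //; apply: ler_wpM2r.
apply: le_trans h1 _; rewrite ler_peMl//; last lra.
by rewrite !mulr_ge0.
Qed.

End smoothness_gain.

(** * The nonlocal terms *)

Section kform_bounds.
Context (R : realType).

Lemma kform_le n (F : Rn R n -> Rn R n -> R) (f g : Rn R n -> R)
    (u : Rn R n * Rn R n -> R) (C A : R) :
  0 <= C -> (forall z, 0 <= u z) -> measurable_fun [set: Rn R n * Rn R n] u ->
  (forall x y, `|F x y * f y * g x| <= C * u (x, y)) ->
  (\int[leb R n \x leb R n]_z (u z)%:E <= A%:E)%E ->
  (`|kform (leb R n) F f g| <= (C * A)%:E)%E.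
Proof.
move=> C0 u0 mu Fu uA.
apply: (@le_trans _ _ (\int[leb R n \x leb R n]_z (C%:E * (u z)%:E))%E).
  by apply: abse_integral_le => -[x y]; rewrite -EFinM abse_EFin lee_fin.
rewrite ge0_integralZl ?lee_fin//; last 2 first.
- exact/measurable_EFinP.
- by move=> z _; rewrite lee_fin.
by rewrite EFinM; apply: lee_wpmul2l.
Qed.

Lemma kform_le_tensor d1 d2 (F : Rn R d1 * Rn R d2 -> Rn R d1 * Rn R d2 -> R)
    (f g : Rn R d1 * Rn R d2 -> R)
    (u1 : Rn R d1 * Rn R d1 -> R) (u2 : Rn R d2 * Rn R d2 -> R) (C A1 A2 : R) :
  0 <= C -> (forall z, 0 <= u1 z) -> (forall z, 0 <= u2 z) ->
  measurable_fun [set: Rn R d1 * Rn R d1] u1 ->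
  measurable_fun [set: Rn R d2 * Rn R d2] u2 ->
  (forall x y, `|F x y * f y * g x| <= C * (u1 (x.1, y.1) * u2 (x.2, y.2))) ->
  (\int[leb R d1 \x leb R d1]_z (u1 z)%:E <= A1%:E)%E ->
  (\int[leb R d2 \x leb R d2]_z (u2 z)%:E <= A2%:E)%E ->
  (`|kform (leb2 R d1 d2) F f g| <= (C * (A1 * A2))%:E)%E.
Proof.
move=> C0 u10 u20 m1 m2 Fu uA1 uA2.
apply: (@le_trans _ _ (\int[leb2 R d1 d2 \x leb2 R d1 d2]_z
    (C%:E * (u1 (z.1.1, z.2.1) * u2 (z.1.2, z.2.2))%:E))%E).
  by apply: abse_integral_le => -[x y]; rewrite -EFinM abse_EFin lee_fin; exact: Fu.
rewrite ge0_integralZl ?lee_fin//; last 2 first.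
- apply/measurable_EFinP; apply: measurable_funM.
  + apply: (measurableT_comp m1); apply: measurable_fun_pair.
      exact: (measurableT_comp measurable_fst measurable_fst).
    exact: (measurableT_comp measurable_fst measurable_snd).
  + apply: (measurableT_comp m2); apply: measurable_fun_pair.
      exact: (measurableT_comp measurable_snd measurable_fst).
    exact: (measurableT_comp measurable_snd measurable_snd).
- by move=> z _; rewrite lee_fin mulr_ge0.
rewrite pair_tensor// EFinM; apply: lee_wpmul2l; first by rewrite lee_fin.
rewrite EFinM; apply: lee_pmul => //; apply: integral_ge0 => z _; by rewrite lee_fin.
Qed.

End kform_bounds.

Section weight_values.
Context (R : realType) (n : nat).
Implicit Types (I J : cube R n) (x y : Rn R n).

Lemma far_weightE I (r b : R) x y : cset I x -> r <= edist x y ->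
  far_weight I r b (x, y) = edist x y `^ (- (n%:R + b)).
Proof.
move=> Ix rxy; rewrite /far_weight /= !indicE mem_set// mul1r.
by rewrite mem_set ?mul1r//=; apply/negP; rewrite -leNgt.
Qed.

Lemma offdiag_weightE I (B : set (Rn R n)) x y : cset I x -> B y -> ~ cset I y ->
  offdiag_weight I B (x, y) = (edist x y ^+ n)^-1.
Proof. by move=> Ix By Iy; rewrite /offdiag_weight /= !indicE !mem_set// !mul1r. Qed.

Lemma diag_weightE I J (a r : R) x y : cset I x -> cset J y ->
  diag_weight I J a r (x, y) = a + (edist x y < r)%R%:R.
Proof.
move=> Ix Jy; rewrite /diag_weight /= !indicE (mem_set Ix) (mem_set Jy) mulr1 mul1r.
by congr (_ + (nat_of_bool _)%:R); apply/idP/idP => [/set_mem//|?]; exact: mem_set.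
Qed.

Lemma far_const_ge0 (b : R) : 0 < b -> 0 <= far_const n b.
Proof.
move=> b0; rewrite divr_ge0 ?exprn_ge0// subr_ge0.
by have /andP[_ /ltW] := powR_half_lt1 b0.
Qed.

End weight_values.

Section term_bounds.
Context (R : realType) (d1 d2 : nat) (T : flagSIO R d1 d2).
Hypotheses (d10 : (0 < d1)%N) (d20 : (0 < d2)%N).
Variables (Q I : rect R d1 d2) (eta : {ffun 'I_d2 -> bool}).
Hypotheses (cQ : is_cube Q) (cI : is_cube I).
Hypotheses (IQ1 : cset I.1 `<=` cset Q.1) (IQ2 : cset I.2 `<=` cset Q.2).
Hypothesis (eta_neq0 : eta != eta0).
Local Notation Rd := (Rn R d1 * Rn R d2)%type.

Let l := side I.2.
Let L := side Q.2.
Let al := alpha2 T.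
Let s1 := Num.sqrt (vol I.1).
Let s2 := Num.sqrt (vol I.2).
Let w1 := haar I.1 eta0.
Let w2 := haar I.2 eta.
Let h := tensor w1 w2.
Let c := center I.2.
Let a2 : Rn R d2 -> R := fun x => s2 * w2 x.

(** The size, up to constants, that the nonlocal terms are shown to have; half of
    the exponent alpha is given up to absorb logarithms. *)
Definition pairing_error : R := Num.sqrt (rvol I) * (l / L) `^ (al / 2).

Let l0 : 0 < l. Proof. exact: side_gt0. Qed.
Let L0 : 0 < L. Proof. exact: side_gt0. Qed.
Let lL : l <= L. Proof. exact: cset_sub_side. Qed.
Let t01 : 0 < l / L <= 1.
Proof. by rewrite divr_gt0//= ler_pdivrMr// mul1r. Qed.
Let al01 : 0 < al <= 1. Proof. exact: alpha2_itv. Qed.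
Let al0 : 0 < al. Proof. by have /andP[] := al01. Qed.
Let al1 : al <= 1. Proof. by have /andP[] := al01. Qed.
Let s10 : 0 < s1. Proof. exact: sqrt_vol_gt0. Qed.
Let s20 : 0 < s2. Proof. exact: sqrt_vol_gt0. Qed.
Let v1E : vol I.1 = s1 * s1. Proof. by rewrite sqrt_vol_sqr. Qed.
Let v2E : vol I.2 = s2 * s2. Proof. by rewrite sqrt_vol_sqr. Qed.
Let errE : pairing_error = s1 * s2 * (l / L) `^ (al / 2).
Proof. by rewrite /pairing_error sqrtrM// ltW// vol_gt0. Qed.
Let sidQ1 : side Q.1 = L. Proof. exact: cQ. Qed.
Let sidI1 : side I.1 = l. Proof. exact: cI. Qed.

Let powt_le p : al / 2 <= p -> (l / L) `^ p <= (l / L) `^ (al / 2).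
Proof. by move=> h1; exact: ger_powR. Qed.

Let far1 x y : cset I.1 x -> ~ cset (triple Q.1) y -> L <= edist x y.
Proof. by rewrite -sidQ1 => /IQ1; exact: triple_far. Qed.

Let far2 x y : cset I.2 x -> ~ cset (triple Q.2) y -> L <= edist x y.
Proof. by move=> /IQ2; exact: triple_far. Qed.

Let far_neq n (x y : Rn R n) : L <= edist x y -> x <> y.
Proof.
move=> Lxy xy; move: Lxy; rewrite xy (_ : edist y y = 0) ?leNgt ?L0//.
by rewrite /edist big1 ?sqrtr0// => i _; rewrite subrr expr0n.
Qed.

Let ratio_pow n : l ^+ n * L `^ (- n%:R) = (l / L) ^+ n.
Proof. by rewrite powR_invn ?(ltW L0)// expr_div_n. Qed.

Let d2_ge : al / 2 <= d2%:R.
Proof. by apply: (@le_trans _ _ 1); [have := al1; have := al0; lra|rewrite ler1n]. Qed.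

Let t_d2 : (l / L) ^+ d2 <= (l / L) `^ (al / 2).
Proof. by rewrite -powR_mulrn ?(ltW (andP t01).1)//; exact: powt_le. Qed.

Lemma integrand_le n (F : Rn R n -> Rn R n -> R) (A : set (Rn R n)) (J : cube R n)
    th x y u : 0 <= u ->
  (cset J x -> A y -> `|F x y| * (Num.sqrt (vol J))^-1 <= u) ->
  `|F x y * \1_A y * haar J th x| <= u.
Proof.
move=> u0 Fu; have [Jx|/haar_out ->] := pselect (cset J x); last first.
  by rewrite mulr0 normr0.
have [Ay|Ay] := pselect (A y); last by rewrite indicE memNset// mulr0 mul0r normr0.
by rewrite indicE mem_set// mulr1 normrM haar_norm indicE mem_set// mulr1 Fu.
Qed.

Lemma integrand2_le (F : Rd -> Rd -> R) (A : set Rd) x y u : 0 <= u ->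
  (cset I.1 x.1 -> cset I.2 x.2 -> A y -> `|F x y| * (s1 * s2)^-1 <= u) ->
  `|F x y * \1_A y * h x| <= u.
Proof.
move=> u0 Fu; rewrite /h /tensor /w1 /w2 mulrA.
have [I1x|/haar_out ->] := pselect (cset I.1 x.1); last by rewrite mulr0 mul0r normr0.
have [I2x|/haar_out ->] := pselect (cset I.2 x.2); last by rewrite mulr0 normr0.
have [Ay|Ay] := pselect (A y); last by rewrite indicE memNset// mulr0 !mul0r normr0.
rewrite indicE mem_set// mulr1 !normrM !haar_norm !indicE !mem_set// !mulr1.
by rewrite -mulrA -invfM; exact: Fu.
Qed.

(** y_1 far and y_2 in I^2.  The size |I^2|^2 |x_1 - y_1|^{-d1-d2} of the partial
    kernel yields (l / L)^{d2}. *)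
Lemma local_strip_bound :
  (`|s2^-1%:E *
     kform (leb R d1) (kpar2 T I.2 (ind I.2) a2) \1_(~` cset (triple Q.1)) w1|
   <= (`|CK T| * far_const d1 d2%:R * pairing_error)%:E)%E.
Proof.
have tp : test_pair I.2 (ind I.2) a2 by apply: Or33; split=> //; exact: atom_haar.
have v20 := vol_gt0 I.2.
have C0 : 0 <= `|CK T| * (vol I.2 ^+ 2 * s1^-1).
  by rewrite !mulr_ge0 ?invr_ge0 ?(ltW s10) ?(ltW v20).
have d2R : 0 < d2%:R :> R by rewrite ltr0n.
have key := @kform_le R d1 (kpar2 T I.2 (ind I.2) a2) \1_(~` cset (triple Q.1)) w1
  (far_weight I.1 L d2%:R) _ _ C0 (@far_weight_ge0 _ _ _ _ _)
  (measurable_far_weight _ _ _) _ (far_integral I.1 L0 d2R).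
rewrite abseM abse_EFin gtr0_norm ?invr_gt0//.
apply: le_trans (lee_wpmul2l _ (key _)) _.
- by rewrite lee_fin invr_ge0 sqrtr_ge0.
- move=> x y; apply: integrand_le; first by rewrite mulr_ge0// far_weight_ge0.
  move=> Ix Qy; have Lxy := far1 Ix Qy; have xy := far_neq Lxy.
  have e0 : 0 < edist x y by apply: lt_le_trans Lxy.
  have S0 : 0 <= vol I.2 ^+ 2 * (edist x y ^+ d1)^-1 * ((edist x y + side I.2) ^+ d2)^-1.
    by rewrite !mulr_ge0 ?invr_ge0 ?exprn_ge0 ?addr_ge0 ?(ltW e0) ?(ltW l0) ?(ltW v20).
  rewrite far_weightE// [leRHS](_ : _ = `|CK T| * (vol I.2 ^+ 2 *
    edist x y `^ (- (d1%:R + d2%:R))) * s1^-1); last by ring.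
  rewrite -/s1 ler_pM2r ?invr_gt0//.
  apply: le_trans (partial_kernel_size (kpar2_kernel T tp) S0 xy) _.
  apply: ler_wpM2l => //; rewrite -(mulrA (vol I.2 ^+ 2)).
  apply: ler_wpM2l; first by rewrite exprn_ge0// ltW.
  rewrite opprD powRD ?(gt_eqF e0) ?implybT// !powR_invn ?(ltW e0)//.
  apply: ler_wpM2l; first by rewrite invr_ge0 exprn_ge0// ltW.
  rewrite lef_pV2 ?posrE ?exprn_gt0 ?addr_gt0// lerXn2r ?nnegrE ?addr_ge0 ?(ltW e0) ?(ltW l0)//.
  by rewrite lerDl ltW.
rewrite -EFinM lee_fin errE !v1E !v2E.
have -> : s2^-1 * (`|CK T| * ((s2 * s2) ^+ 2 * s1^-1) *
    (far_const d1 d2%:R * (s1 * s1 * L `^ (- d2%:R)))) =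
    `|CK T| * far_const d1 d2%:R * (s1 * s2 * (s2 * s2 * L `^ (- d2%:R))).
  by field; rewrite !gt_eqF.
apply: ler_wpM2l; first by rewrite mulr_ge0// far_const_ge0.
apply: ler_wpM2l; first by rewrite mulr_ge0// ltW.
by rewrite -v2E ratio_pow; exact: t_d2.
Qed.

Let L1c x y := kpar1 T I.1 (ind I.1) (ind I.1) x y - kpar1 T I.1 (ind I.1) (ind I.1) c y.

(** y_1 in I^1 and y_2 far: the gain in the second parameter yields (l / L)^alpha. *)
Lemma local_far_bound :
  (`|s1^-1%:E * kform (leb R d2) L1c \1_(~` cset (triple Q.2)) w2|
   <= (`|CK T| * gain_const R d2 * far_const d2 al * pairing_error)%:E)%E.
Proof.
have tp : test_pair I.1 (ind I.1) (ind I.1) by apply: Or31.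
have v10 := vol_gt0 I.1.
have g0 : 0 <= gain_const R d2 by rewrite mulr_ge0// addr_ge0// exprn_ge0// mulr_ge0.
have C0 : 0 <= `|CK T| * gain_const R d2 * (vol I.1 * (l `^ al * s2^-1)).
  by rewrite !mulr_ge0 ?invr_ge0 ?(ltW s20) ?(ltW v10) ?powR_ge0.
have key := @kform_le R d2 L1c \1_(~` cset (triple Q.2)) w2
  (far_weight I.2 L al) _ _ C0 (@far_weight_ge0 _ _ _ _ _)
  (measurable_far_weight _ _ _) _ (far_integral I.2 L0 al0).
rewrite abseM abse_EFin gtr0_norm ?invr_gt0//.
apply: le_trans (lee_wpmul2l _ (key _)) _.
- by rewrite lee_fin invr_ge0 sqrtr_ge0.
- move=> x y; apply: integrand_le; first by rewrite mulr_ge0// far_weight_ge0.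
  move=> Ix Qy; have Lxy := far2 Ix Qy; have xy := far_neq Lxy.
  have Lcy := far2 (center_in I.2) Qy; have cy := far_neq Lcy.
  have e0 : 0 < edist x y by apply: lt_le_trans Lxy.
  have e'0 : 0 < edist c y by apply: lt_le_trans Lcy.
  have S0 (z : Rn R d2) : 0 <= vol I.1 * (edist z y ^+ d2)^-1.
    by rewrite mulr_ge0 ?(ltW v10)// invr_ge0 exprn_ge0// edist_ge0.
  rewrite far_weightE// [leRHS](_ : _ = `|CK T| * gain_const R d2 *
     (l `^ al * (vol I.1 * edist x y `^ (- (d2%:R + al)))) * s2^-1); last by ring.
  rewrite -/s2 ler_pM2r ?invr_gt0//.
  have kk := kpar1_kernel T tp.
  have := @far_gain R (kpar1 T I.1 (ind I.1) (ind I.1) x y)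
    (kpar1 T I.1 (ind I.1) (ind I.1) c y) `|CK T| (vol I.1) 0 (edist x y) (edist c y)
    (edist c x) l al d2 d20 l0 (lexx _) (center_near Ix) (edist_ge0 _ _)
    (le_trans lL Lxy) (le_trans lL Lcy) al01 (normr_ge0 _) (ltW v10).
  rewrite !add0r => H; apply: le_trans (H _ _ _) _.
  + exact: (partial_kernel_size kk (S0 _) xy).
  + exact: (partial_kernel_size kk (S0 _) cy).
  + exact: (partial_kernel_holder kk (S0 _) xy).
  apply: ler_wpM2l; first by rewrite mulr_ge0.
  rewrite opprD powRD ?(gt_eqF e0) ?implybT// powR_invn ?(ltW e0)//.
  rewrite powRM ?invr_ge0 ?(ltW l0) ?(ltW e0)// -powR_inv1 ?(ltW e0)// -powRrM mulN1r.
  by rewrite le_eqVlt; apply/orP; left; apply/eqP; ring.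
rewrite -EFinM lee_fin errE !v1E !v2E.
have -> : s1^-1 * (`|CK T| * gain_const R d2 * (s1 * s1 * (l `^ al * s2^-1)) *
    (far_const d2 al * (s2 * s2 * L `^ (- al)))) =
    `|CK T| * gain_const R d2 * far_const d2 al * (s1 * s2 * (l `^ al * L `^ (- al))).
  by field; rewrite !gt_eqF.
apply: ler_wpM2l; first by rewrite mulr_ge0 ?far_const_ge0// mulr_ge0.
apply: ler_wpM2l; first by rewrite mulr_ge0// ltW.
rewrite -mulN1r (powRrM L) powR_inv1 ?(ltW L0)// -powRM ?invr_ge0 ?(ltW l0) ?(ltW L0)//.
by apply: powt_le; have := al0; lra.
Qed.

Let Kc (x y : Rd) := kfull T x y - kfull T (x.1, c) y.

Let hC : 0 <= `|CK T| * gain_const R d2 * (l `^ al * (s1 * s2)^-1).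
Proof.
have g0 : 0 <= gain_const R d2 by rewrite mulr_ge0// addr_ge0// exprn_ge0// mulr_ge0.
by rewrite mulr_ge0 ?mulr_ge0 ?powR_ge0 ?invr_ge0// mulr_ge0// ltW.
Qed.

Let Kc_far x y : cset I.2 x.2 -> ~ cset (triple Q.2) y.2 -> x.1 <> y.1 ->
  `|Kc x y| <= `|CK T| * gain_const R d2 * ((l / edist x.2 y.2) `^ al *
     ((edist x.1 y.1 ^+ d1)^-1 * ((edist x.1 y.1 + edist x.2 y.2) ^+ d2)^-1)).
Proof.
move=> Ix Qy xy; have Lxy := far2 Ix Qy; have Lcy := far2 (center_in I.2) Qy.
have kk := kfull_kernel T.
apply: (@far_gain R _ _ _ _ _ _ (edist c y.2) (edist c x.2)) => //.
- exact: edist_ge0.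
- exact: center_near.
- exact: edist_ge0.
- exact: le_trans Lxy.
- exact: le_trans Lcy.
- by rewrite invr_ge0 exprn_ge0// edist_ge0.
- exact: (full_kernel_size kk xy).
- exact: (@full_kernel_size _ _ _ _ _ _ _ (x.1, c) y kk xy).
- exact: (full_kernel_holder kk xy).
Qed.

(** y_1 near but outside I^1, and y_2 far: the gain (l / L)^alpha pays for the
    factor (L / l)^{alpha/2} of [offdiag_integral]. *)
Lemma offdiag_far_bound :
  (`|kform (leb2 R d1 d2) Kc
       \1_((cset (triple Q.1) `\` cset I.1) `*` ~` cset (triple Q.2)) h|
   <= (`|CK T| * gain_const R d2 * boundary_const d1 (al / 2) * (d1%:R * 2) `^ (al / 2)
       * far_const d2 al * pairing_error)%:E)%E.
Proof.
have e0 : 0 < al / 2 by have := al0; lra.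
have e1 : al / 2 <= 1 / 2 by have := al1; lra.
have D0 : 0 <= d1%:R * (2 * L) by rewrite !mulr_ge0// ltW.
have ID x y : cset I.1 x -> cset (triple Q.1) y -> edist x y <= d1%:R * (2 * L).
  by move=> /IQ1 Qx Qy; rewrite -sidQ1; exact: triple_near.
have mQ1 := measurable_cset (triple Q.1).
apply: le_trans (kform_le_tensor hC (@offdiag_weight_ge0 _ _ _ _)
  (@far_weight_ge0 _ _ _ _ _) (measurable_offdiag_weight I.1 mQ1) (measurable_far_weight I.2 L al) _
  (offdiag_integral d10 e0 e1 D0 ID) (far_integral I.2 L0 al0)) _.
- move=> x y; apply: integrand2_le.
    by rewrite mulr_ge0 ?hC// mulr_ge0 ?far_weight_ge0 ?offdiag_weight_ge0.
  move=> I1x I2x [[Q1y I1y] Q2y].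
  have Lxy := far2 I2x Q2y; have xy2 := far_neq Lxy.
  have b0 : 0 < edist x.2 y.2 by apply: lt_le_trans Lxy.
  have xy1 : x.1 <> y.1 by move=> e; apply: I1y; rewrite -e.
  have a0 : 0 < edist x.1 y.1 by exact: edist_gt0.
  rewrite offdiag_weightE// far_weightE// [leRHS](_ : _ = `|CK T| * gain_const R d2 *
    (l `^ al * ((edist x.1 y.1 ^+ d1)^-1 * edist x.2 y.2 `^ (- (d2%:R + al))))
    * (s1 * s2)^-1); last by ring.
  rewrite ler_pM2r ?invr_gt0 ?mulr_gt0//; apply: le_trans (Kc_far I2x Q2y xy1) _.
  apply: ler_wpM2l.
    by rewrite mulr_ge0// mulr_ge0// addr_ge0// exprn_ge0// mulr_ge0.
  rewrite opprD powRD ?(gt_eqF b0) ?implybT// powR_invn ?(ltW b0)//.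
  rewrite powRM ?invr_ge0 ?(ltW l0) ?(ltW b0)// -powR_inv1 ?(ltW b0)// -powRrM mulN1r.
  rewrite -mulrA; apply: ler_wpM2l; first exact: powR_ge0.
  rewrite mulrC -!mulrA; apply: ler_wpM2l; first by rewrite invr_ge0 exprn_ge0// ltW.
  apply: ler_wpM2r; first exact: powR_ge0.
  rewrite lef_pV2 ?posrE ?exprn_gt0 ?addr_gt0// lerXn2r ?nnegrE ?addr_ge0 ?(ltW b0) ?(ltW a0)//.
  by rewrite lerDr ltW.
rewrite lee_fin errE sidI1 v1E v2E.
have -> : (d1%:R * (2 * L) / l) `^ (al / 2) =
    (d1%:R * 2) `^ (al / 2) * (l / L) `^ (- (al / 2)).
  rewrite -mulN1r (powRrM (l / L)) powR_inv1; last by rewrite divr_ge0// ltW.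
  rewrite -powRM ?mulr_ge0// ?invr_ge0 ?divr_ge0 ?(ltW l0) ?(ltW L0)//.
  by congr (_ `^ _); field; rewrite !gt_eqF ?l0 ?L0.
have -> : `|CK T| * gain_const R d2 * (l `^ al * (s1 * s2)^-1) *
    (boundary_const d1 (al / 2) * (s1 * s1 * ((d1%:R * 2) `^ (al / 2) *
       (l / L) `^ (- (al / 2)))) *
     (far_const d2 al * (s2 * s2 * L `^ (- al)))) =
   `|CK T| * gain_const R d2 * boundary_const d1 (al / 2) * (d1%:R * 2) `^ (al / 2)
       * far_const d2 al * (s1 * s2 *
     ((l `^ al * L `^ (- al)) * (l / L) `^ (- (al / 2)))).
  by field; rewrite !gt_eqF.
have -> : l `^ al * L `^ (- al) = (l / L) `^ al.
  rewrite -mulN1r (powRrM L) powR_inv1 ?(ltW L0)//.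
  by rewrite -powRM ?invr_ge0 ?(ltW l0) ?(ltW L0).
have t0 : 0 < l / L by rewrite divr_gt0.
rewrite -powRD; last by rewrite (gt_eqF t0) implybT.
by rewrite le_eqVlt; apply/orP; left; apply/eqP; congr (_ * (_ * _ `^ _)); field.
Qed.

(** Both variables far.  The factor (a + b)^{-d2} is split as
    a^{-alpha/2} b^{-d2+alpha/2}, which leaves the exponent alpha/2 for convergence
    in each of the two parameters. *)
Lemma far_far_bound :
  (`|kform (leb2 R d1 d2) Kc \1_(~` cset (triple Q.1) `*` ~` cset (triple Q.2)) h|
   <= (`|CK T| * gain_const R d2 * far_const d1 (al / 2) * far_const d2 (al / 2)
       * pairing_error)%:E)%E.
Proof.
have e0 : 0 < al / 2 by have := al0; lra.
apply: le_trans (kform_le_tensor hC (@far_weight_ge0 _ _ _ _ _)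
  (@far_weight_ge0 _ _ _ _ _) (measurable_far_weight I.1 L (al / 2))
  (measurable_far_weight I.2 L (al / 2)) _
  (far_integral I.1 L0 e0) (far_integral I.2 L0 e0)) _.
- move=> x y; apply: integrand2_le.
    by rewrite mulr_ge0 ?hC// mulr_ge0 ?far_weight_ge0.
  move=> I1x I2x [Q1y Q2y].
  have Lxy1 := far1 I1x Q1y; have xy1 := far_neq Lxy1.
  have Lxy2 := far2 I2x Q2y.
  have b0 : 0 < edist x.2 y.2 by apply: lt_le_trans Lxy2.
  have a0 : 0 < edist x.1 y.1 by apply: lt_le_trans Lxy1.
  rewrite !far_weightE// [leRHS](_ : _ = `|CK T| * gain_const R d2 *
    (l `^ al * (edist x.1 y.1 `^ (- (d1%:R + al / 2)) * edist x.2 y.2 `^ (- (d2%:R + al / 2))))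
    * (s1 * s2)^-1); last by ring.
  rewrite ler_pM2r ?invr_gt0 ?mulr_gt0//; apply: le_trans (Kc_far I2x Q2y xy1) _.
  apply: ler_wpM2l.
    by rewrite mulr_ge0// mulr_ge0// addr_ge0// exprn_ge0// mulr_ge0.
  rewrite powRM ?invr_ge0 ?(ltW l0) ?(ltW b0)// -powR_inv1 ?(ltW b0)// -powRrM mulN1r.
  rewrite -mulrA; apply: ler_wpM2l; first exact: powR_ge0.
  move: a0 b0; move: (edist x.1 y.1) (edist x.2 y.2) => a b a0 b0.
  have ab0 : 0 < a + b by rewrite addr_gt0.
  have -> : a `^ (- (d1%:R + al / 2)) = (a ^+ d1)^-1 * a `^ (- (al / 2)).
    by rewrite opprD powRD ?(gt_eqF a0) ?implybT// powR_invn// ltW.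
  have -> : b `^ (- (d2%:R + al / 2)) = b `^ (- al) * b `^ (- (d2%:R - al / 2)).
    by rewrite -powRD ?(gt_eqF b0) ?implybT//; congr (_ `^ _); field.
  have -> : ((a + b) ^+ d2)^-1 = (a + b) `^ (- (al / 2)) * (a + b) `^ (- (d2%:R - al / 2)).
    rewrite -powRD ?(gt_eqF ab0) ?implybT// -powR_invn ?(ltW ab0)//.
    by congr (_ `^ _); field.
  rewrite mulrCA -[leRHS]mulrA; apply: ler_wpM2l; first by rewrite invr_ge0 exprn_ge0// ltW.
  rewrite [leRHS]mulrCA; apply: ler_wpM2l; first exact: powR_ge0.
  apply: ler_pM; rewrite ?powR_ge0//; apply: ler_powRN => //; rewrite ?(ltW e0)//.
  + by rewrite lerDl ltW.
  + by rewrite lerDr ltW.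
  + by rewrite subr_ge0.
rewrite lee_fin errE v1E v2E.
have -> : `|CK T| * gain_const R d2 * (l `^ al * (s1 * s2)^-1) *
    (far_const d1 (al / 2) * (s1 * s1 * L `^ (- (al / 2))) *
     (far_const d2 (al / 2) * (s2 * s2 * L `^ (- (al / 2))))) =
   `|CK T| * gain_const R d2 * far_const d1 (al / 2) * far_const d2 (al / 2) * (s1 * s2 *
     (l `^ al * (L `^ (- (al / 2)) * L `^ (- (al / 2))))).
  by field; rewrite !gt_eqF.
have -> : L `^ (- (al / 2)) * L `^ (- (al / 2)) = L `^ (- al).
  by rewrite -powRD ?(gt_eqF L0) ?implybT//; congr (_ `^ _); field.
have -> : l `^ al * L `^ (- al) = (l / L) `^ al.
  rewrite -mulN1r (powRrM L) powR_inv1 ?(ltW L0)//.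
  by rewrite -powRM ?invr_ge0 ?(ltW l0) ?(ltW L0).
apply: ler_wpM2l.
  rewrite mulr_ge0 ?far_const_ge0// mulr_ge0 ?far_const_ge0//.
  by rewrite mulr_ge0// mulr_ge0// addr_ge0// exprn_ge0// mulr_ge0.
apply: ler_wpM2l; first by rewrite mulr_ge0// ltW.
by apply: powt_le; have := al0; lra.
Qed.

Let strip : set (Rd * Rd) :=
  [set z | cset I.1 z.1.1 /\ ~ cset (triple Q.1) z.2.1].

Let mfst1 : measurable_fun [set: Rd * Rd] (fun z : Rd * Rd => z.1.1).
Proof. exact: (measurableT_comp measurable_fst measurable_fst). Qed.
Let msnd1 : measurable_fun [set: Rd * Rd] (fun z : Rd * Rd => z.2.1).
Proof. exact: (measurableT_comp measurable_fst measurable_snd). Qed.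

Let mstrip : measurable strip.
Proof.
rewrite (_ : strip = ([set: Rd * Rd] `&` (fun z : Rd * Rd => z.1.1) @^-1` cset I.1) `&`
  ([set: Rd * Rd] `&` (fun z : Rd * Rd => z.2.1) @^-1` (~` cset (triple Q.1)))).
  apply: measurableI; first by apply: mfst1 => //; exact: measurable_cset.
  by apply: msnd1 => //; apply: measurableC; exact: measurable_cset.
by rewrite !setTI.
Qed.

Let mKstrip : measurable_fun [set: Rd * Rd]
  (fun z : Rd * Rd => \1_strip z * kfull T z.1 z.2).
Proof.
pose E := [set z : Rd * Rd | z.1.1 <> z.2.1].
have mE : measurable E.
  rewrite (_ : E = [set: Rd * Rd] `&` (fun z : Rd * Rd => edist z.1.1 z.2.1) @^-1` `]0, +oo[).
    by apply: measurable_edist.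
  rewrite setTI; apply/seteqP; split=> z /=; rewrite in_itv/= andbT.
    exact: edist_gt0.
  by rewrite ltNge => /negP ne e; apply: ne; rewrite e (_ : edist _ _ = 0)//
    /edist big1 ?sqrtr0// => i _; rewrite subrr expr0n.
have sE : strip `<=` E.
  by move=> z [Ix Qy]; exact: (far_neq (far1 Ix Qy)).
have := measurable_funS mE sE (kfull_measurable T).
move=> /(measurable_restrictT _ mstrip); congr (measurable_fun _ _).
apply/funext => z; rewrite /patch indicE; case: ifP => _; first by rewrite mul1r.
by rewrite mul0r.
Qed.

Let mKcstrip : measurable_fun [set: Rd * Rd]
  (fun z : Rd * Rd => \1_strip z * kfull T (z.1.1, c) z.2).
Proof.
have mphi : measurable_fun [set: Rd * Rd] (fun z : Rd * Rd => (((z.1.1, c) : Rd), z.2)).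
  by apply: measurable_fun_pair => //; apply: measurable_fun_pair.
exact: (measurableT_comp mKstrip mphi).
Qed.

Let A : set Rd := ~` cset (triple Q.1) `*` (cset (triple Q.2) `\` cset I.2).

Let mA : measurable A.
Proof.
apply: measurableX; first by apply: measurableC; exact: measurable_cset.
by apply: measurableD; exact: measurable_cset.
Qed.

Let strip_integrable (F : Rd -> Rd -> R) :
  measurable_fun [set: Rd * Rd] (fun z : Rd * Rd => \1_strip z * F z.1 z.2) ->
  (forall x y, x.1 <> y.1 ->
    `|F x y| <= `|CK T| * ((edist x.1 y.1 ^+ d1)^-1 * (edist x.1 y.1 ^+ d2)^-1)) ->
  (leb2 R d1 d2 \x leb2 R d1 d2)%E.-integrable setT
    (fun z => (F z.1 z.2 * \1_A z.2 * h z.1)%:E).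
Proof.
move=> mF Fle; apply/integrableP; split.
  rewrite (_ : (fun z => _) = (fun z => (\1_strip z * F z.1 z.2 * \1_A z.2 * h z.1)%:E)).
    apply/measurable_EFinP; apply: measurable_funM.
      apply: measurable_funM => //.
      exact: (measurableT_comp (measurable_indic mA) measurable_snd).
    apply: measurable_funM.
      exact: (measurableT_comp (measurable_haar _ _) mfst1).
    apply: (measurableT_comp (measurable_haar _ _)).
    exact: (measurableT_comp measurable_snd measurable_fst).
  apply/funext => z; congr EFin; rewrite /h /tensor /w1 /w2.
  have [I1x|/haar_out ->] := pselect (cset I.1 z.1.1); last by rewrite mul0r !mulr0.
  have [Az|Az] := pselect (A z.2); last first.
    by rewrite (indicE _ A) memNset// mulr0 !mul0r !mulr0 mul0r.
  by rewrite (indicE _ strip) mem_set ?mul1r//; split=> //; case: Az.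
have d2R : 0 < d2%:R :> R by rewrite ltr0n.
have C0 : 0 <= `|CK T| * (s1 * s2)^-1 by rewrite mulr_ge0// invr_ge0 mulr_ge0// ltW.
have := @kform_le_tensor R d1 d2 (fun x y => `|F x y * \1_A y * h x|) (cst 1) (cst 1)
  _ _ _ _ _ C0 (@far_weight_ge0 _ _ _ _ _)
  (fun z => diag_weight_ge0 _ _ _ _ ler01) (measurable_far_weight I.1 L d2%:R)
  (measurable_diag_weight I.2 (triple Q.2) 1 1) _
  (far_integral I.1 L0 d2R) (diag_integral I.2 (triple Q.2) ler01 ltr01).
rewrite /kform => H.
rewrite (eq_integral (fun z : Rd * Rd =>
  (`|F z.1 z.2 * \1_A z.2 * h z.1| * cst 1 z.2 * cst 1 z.1)%:E)); last first.
  by move=> z _; rewrite /= !mulr1.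
apply: le_lt_trans (le_trans (lee_abs _) (H _)) (ltry _).
move=> x y; rewrite !mulr1 normr_id; apply: integrand2_le.
  by rewrite mulr_ge0// mulr_ge0 ?far_weight_ge0 ?diag_weight_ge0.
move=> I1x I2x [Q1y [Q2y I2y]].
have Lxy := far1 I1x Q1y; have xy := far_neq Lxy.
have a0 : 0 < edist x.1 y.1 by apply: lt_le_trans Lxy.
rewrite far_weightE// diag_weightE// mulrAC ler_pM2r ?invr_gt0 ?mulr_gt0//.
apply: le_trans (Fle _ _ xy) _; apply: ler_wpM2l => //.
rewrite opprD powRD ?(gt_eqF a0) ?implybT// !powR_invn ?(ltW a0)//.
by rewrite ler_peMr ?lerDl// mulr_ge0// invr_ge0 exprn_ge0// ltW.
Qed.

Let size_strip (c' : Rn R d2) (x y : Rd) : x.1 <> y.1 ->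
  `|kfull T (x.1, c') y| <=
    `|CK T| * ((edist x.1 y.1 ^+ d1)^-1 * (edist x.1 y.1 ^+ d2)^-1).
Proof.
move=> xy; have a0 : 0 < edist x.1 y.1 by exact: edist_gt0.
apply: le_trans (@full_kernel_size _ _ _ _ _ _ _ (x.1, c') y (kfull_kernel T) xy) _.
apply: ler_wpM2l => //; apply: ler_wpM2l; first by rewrite invr_ge0 exprn_ge0// ltW.
rewrite lef_pV2 ?posrE ?exprn_gt0 ?ltr_wpDr ?edist_ge0// lerXn2r ?nnegrE ?addr_ge0 ?edist_ge0//.
by rewrite lerDl edist_ge0.
Qed.

(** The kernel with x_2 frozen at the center depends on x_2 only through h_{I^2}.
    The order of integration has y outside: for fixed y in the strip the frozen
    kernel is bounded in x_1, so that the tensor product is integrable. *)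
Let frozen_integral0 :
  (\int[leb2 R d1 d2 \x leb2 R d1 d2]_z
     (kfull T (z.1.1, c) z.2 * \1_A z.2 * h z.1)%:E = 0)%E.
Proof.
have intG := strip_integrable (F := fun x y => kfull T (x.1, c) y) mKcstrip (size_strip c).
rewrite -(integral21_prod_meas1 intG); apply: integral0_eq => y _; rewrite /fubini_G /=.
have [Ay|Ay] := pselect (A y); last first.
  by apply: integral0_eq => x _; rewrite indicE memNset// mulr0 mul0r.
have [Q1y _] := Ay.
pose g (x1 : Rn R d1) : R := \1_(cset I.1) x1 * kfull T (x1, c) y * haar I.1 eta0 x1.
rewrite (eq_integral (fun x : Rd => (g x.1 * w2 x.2)%:E)); last first.
  move=> x _; rewrite /h /tensor /w1 /w2 /g indicE mem_set// mulr1 mulrA.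
  have [I1x|/haar_out ->] := pselect (cset I.1 x.1); last by rewrite !mulr0.
  by rewrite (indicE _ (cset I.1)) mem_set// mul1r.
have intg : (leb R d1).-integrable setT (EFin \o g).
  apply: (@bounded_integrable _ _ _ _ (cset I.1)
    (`|CK T| * ((L ^+ d1)^-1 * (L ^+ d2)^-1) * s1^-1)).
  - exact: measurable_cset.
  - by rewrite [X in (X < _)%E]leb_cset ltry.
  - apply: measurable_funM; last exact: measurable_haar.
    have mpsi : measurable_fun [set: Rn R d1]
        (fun x1 : Rn R d1 => (((x1, c) : Rd), y)).
      by apply: measurable_fun_pair => //; apply: measurable_fun_pair.
    rewrite (_ : (fun x1 => _) =
      (fun z : Rd * Rd => \1_strip z * kfull T z.1 z.2) \o (fun x1 => (((x1, c) : Rd), y))).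
      exact: (measurableT_comp mKstrip mpsi).
    apply/funext => x1 /=; congr (_ * _); rewrite !indicE; congr (nat_of_bool _)%:R.
    by apply/idP/idP => /set_mem Ix; apply: mem_set => //; case: Ix.
  - move=> x1; rewrite /g !normrM haar_norm.
    have [Ix|Ix] := pselect (cset I.1 x1); last by rewrite indicE memNset// !mulr0.
    rewrite indicE mem_set// normr1 mul1r !mulr1 ler_pM2r ?invr_gt0//.
    have Lxy := far1 Ix Q1y; have xy := far_neq Lxy.
    have a0 : 0 < edist x1 y.1 by apply: lt_le_trans Lxy.
    apply: le_trans (@size_strip c (x1, c) y xy) _; apply: ler_wpM2l => //=.
    by apply: ler_pM; rewrite ?invr_ge0 ?exprn_ge0 ?(ltW a0)//;
      rewrite lef_pV2 ?posrE ?exprn_gt0// lerXn2r ?nnegrE// ltW.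
rewrite [LHS](integral_tensor intg (integrable_haar I.2 eta)).
by rewrite [X in (_ * X)%E]integral_haar// mule0.
Qed.

Let strip_freeze :
  kform (leb2 R d1 d2) (kfull T) \1_A h = kform (leb2 R d1 d2) Kc \1_A h.
Proof.
have size_K (x y : Rd) : x.1 <> y.1 -> `|kfull T x y| <=
    `|CK T| * ((edist x.1 y.1 ^+ d1)^-1 * (edist x.1 y.1 ^+ d2)^-1).
  by move=> xy; have := size_strip x.2 xy; rewrite -surjective_pairing.
have intF := strip_integrable (F := kfull T) mKstrip size_K.
have intG := strip_integrable (F := fun x y => kfull T (x.1, c) y) mKcstrip (size_strip c).
rewrite /kform -[LHS]sube0 -frozen_integral0 -integralB_EFin//.
by apply: eq_integral => z _; rewrite -EFinB -!mulrBl.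
Qed.

(** y_1 far, y_2 near but outside I^2.  The subtraction is not part of the
    definition of this term; it is legitimate because the kernel is absolutely
    integrable over the strip. *)
Lemma strip_bound :
  (`|kform (leb2 R d1 d2) (kfull T) \1_A h|
   <= (2 * `|CK T| * far_const d1 d2%:R * (3 ^+ d2 + (4 * d2%:R) ^+ d2)
       * pairing_error)%:E)%E.
Proof.
rewrite strip_freeze.
set s := Num.sqrt (l * L).
have s0 : 0 < s by rewrite sqrtr_gt0 mulr_gt0.
have r0 : 0 < 2 * d2%:R * s by rewrite !mulr_gt0// ltr0n.
have d2R : 0 < d2%:R :> R by rewrite ltr0n.
have t0 : 0 <= (l / L) `^ (al / 2) := powR_ge0 _ _.
have C0 : 0 <= 2 * `|CK T| * (s1 * s2)^-1.
  by rewrite !mulr_ge0 ?invr_ge0// mulr_ge0// ltW.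
apply: le_trans (kform_le_tensor C0 (@far_weight_ge0 _ _ _ _ _)
  (fun z => diag_weight_ge0 _ _ _ _ t0) (measurable_far_weight I.1 L d2%:R)
  (measurable_diag_weight I.2 (triple Q.2) _ _) _
  (far_integral I.1 L0 d2R) (diag_integral I.2 (triple Q.2) t0 r0)) _.
- move=> x y; apply: integrand2_le.
    by rewrite mulr_ge0 ?C0// mulr_ge0 ?far_weight_ge0 ?diag_weight_ge0.
  move=> I1x I2x [Q1y [Q2y I2y]].
  have Lxy := far1 I1x Q1y; have xy := far_neq Lxy.
  have a0 : 0 < edist x.1 y.1 by apply: lt_le_trans Lxy.
  rewrite far_weightE// diag_weightE// [leRHS](_ : _ = 2 * `|CK T| *
    (((l / L) `^ (al / 2) + (edist x.2 y.2 < 2 * d2%:R * s)%R%:R) *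
     edist x.1 y.1 `^ (- (d1%:R + d2%:R))) * (s1 * s2)^-1); last by ring.
  rewrite ler_pM2r ?invr_gt0 ?mulr_gt0//.
  rewrite opprD powRD ?(gt_eqF a0) ?implybT// !powR_invn ?(ltW a0)//.
  have W0 : 0 <= (edist x.1 y.1 ^+ d1)^-1 * (edist x.1 y.1 ^+ d2)^-1.
    by rewrite mulr_ge0// invr_ge0 exprn_ge0// ltW.
  apply: (near_gain d20 l0 lL (center_near I2x) (edist_ge0 _ _) (edist_ge0 _ _) al01
     (normr_ge0 _) W0).
  + by have := size_strip x.2 xy; rewrite -surjective_pairing.
  + exact: size_strip.
  + move=> xc; apply: le_trans (full_kernel_holder (kfull_kernel T) xy xc) _.
    apply: ler_wpM2l; first by rewrite mulr_ge0// powR_ge0.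
    apply: ler_wpM2l; first by rewrite invr_ge0 exprn_ge0// ltW.
    rewrite lef_pV2 ?posrE ?exprn_gt0 ?ltr_wpDr ?edist_ge0//.
    rewrite lerXn2r ?nnegrE ?addr_ge0 ?edist_ge0//.
    by rewrite lerDl edist_ge0.
rewrite lee_fin errE v1E v2E.
have sn : (2 * (2 * d2%:R * s)) ^+ d2 <= (4 * d2%:R) ^+ d2 * (L ^+ d2 * (l / L) `^ (al / 2)).
  rewrite (_ : 2 * (2 * d2%:R * s) = 4 * d2%:R * s); last by ring.
  rewrite exprMn; apply: ler_wpM2l; first by rewrite exprn_ge0// mulr_ge0.
  have -> : s = L * (l / L) `^ (2^-1).
    rewrite powR12_sqrt ?divr_ge0 ?(ltW l0) ?(ltW L0)//.
    rewrite -{1}(ger0_norm (ltW L0)) -sqrtr_sqr -sqrtrM ?sqr_ge0//.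
    by congr Num.sqrt; field; rewrite gt_eqF ?L0.
  rewrite exprMn -(powR_mulrn d2 (powR_ge0 (l / L) 2^-1)) -powRrM.
  apply: ler_wpM2l; first by rewrite exprn_ge0// ltW.
  apply: powt_le; rewrite mulrC ler_pM2l ?invr_gt0//.
  by apply: le_trans al1 _; rewrite ler1n.
have h1 : (l / L) `^ (al / 2) * vol (triple Q.2) + (2 * (2 * d2%:R * s)) ^+ d2 <=
    (3 ^+ d2 + (4 * d2%:R) ^+ d2) * (L ^+ d2 * (l / L) `^ (al / 2)).
  rewrite vol_triple [leRHS]mulrDl; apply: lerD => //.
  by rewrite /vol -/L le_eqVlt; apply/orP; left; apply/eqP; ring.
have LL : L `^ (- d2%:R) * L ^+ d2 = 1.
  by rewrite powR_invn ?(ltW L0)// mulVf// expf_neq0// gt_eqF ?L0.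
apply: (@le_trans _ _ (2 * `|CK T| * (s1 * s2)^-1 *
    (far_const d1 d2%:R * (s1 * s1 * L `^ (- d2%:R)) *
     (s2 * s2 * ((3 ^+ d2 + (4 * d2%:R) ^+ d2) * (L ^+ d2 * (l / L) `^ (al / 2))))))).
  apply: ler_wpM2l => //; apply: ler_wpM2l.
    rewrite mulr_ge0 ?far_const_ge0// !mulr_ge0 ?powR_ge0// ltW//.
  apply: ler_wpM2l => //; by rewrite mulr_ge0// ltW.
rewrite le_eqVlt; apply/orP; left; apply/eqP.
transitivity (2 * `|CK T| * far_const d1 d2%:R * (3 ^+ d2 + (4 * d2%:R) ^+ d2) *
   (s1 * s2 * (l / L) `^ (al / 2)) * (L `^ (- d2%:R) * L ^+ d2)).
  by field; rewrite !gt_eqF.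
by rewrite LL mulr1.
Qed.

End term_bounds.

Section pairing_bound.
Context (R : realType) (d1 d2 : nat) (T : flagSIO R d1 d2).

Definition pairing_const : R :=
  `|CK T| * far_const d1 d2%:R
  + 2 * `|CK T| * far_const d1 d2%:R * (3 ^+ d2 + (4 * d2%:R) ^+ d2)
  + `|CK T| * gain_const R d2 * far_const d2 (alpha2 T)
  + `|CK T| * gain_const R d2 * boundary_const d1 (alpha2 T / 2)
      * (d1%:R * 2) `^ (alpha2 T / 2) * far_const d2 (alpha2 T)
  + `|CK T| * gain_const R d2 * far_const d1 (alpha2 T / 2) * far_const d2 (alpha2 T / 2).

Definition triple_rect (Q : rect R d1 d2) : rect R d1 d2 := (triple Q.1, triple Q.2).

Lemma T1_pairing_bound (Q I : rect R d1 d2) (eta : {ffun 'I_d2 -> bool}) :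
  (0 < d1)%N -> (0 < d2)%N -> is_cube Q -> is_cube I ->
  cset I.1 `<=` cset Q.1 -> cset I.2 `<=` cset Q.2 -> eta != eta0 ->
  (`|T1_pairing T Q I eta| <=
    (`|form T (rind (triple_rect Q)) (rect_haar (I, eta))|
     + pairing_const * pairing_error T Q I)%:E)%E.
Proof.
move=> d10 d20 cQ cI IQ1 IQ2 eta_neq0.
have B1 := local_strip_bound T d20 cQ IQ1 IQ2 eta_neq0.
have B2 := strip_bound T d20 cQ IQ1 IQ2 eta_neq0.
have B3 := local_far_bound T d20 eta IQ2.
have B4 := offdiag_far_bound T d10 d20 eta cQ cI IQ1 IQ2.
have B5 := far_far_bound T d20 eta cQ IQ1 IQ2.
have add_le (x y : \bar R) (a b : R) :
    (`|x| <= a%:E -> `|y| <= b%:E -> `|x + y| <= (a + b)%:E)%E.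
  by move=> xa yb; rewrite EFinD (le_trans (lee_abs_add _ _))// leeD.
rewrite /pairing_const; set c1 := `|CK T| * _; set c2 := _ * (_ + _).
set c3 := _ * far_const d2 (alpha2 T); set c4 := _ * far_const d2 (alpha2 T).
set c5 := _ * far_const d2 (alpha2 T / 2).
set f := `|form _ _ _|; set err := pairing_error T Q I.
rewrite (_ : f + _ = f + (c1 * err + c2 * err) + (c3 * err + c4 * err) + c5 * err); last by ring.
apply: (add_le _ _ _ _ _ B5); apply: (add_le _ _ _ _ _ (add_le _ _ _ _ B3 B4)).
by apply: (add_le _ _ _ _ _ (add_le _ _ _ _ B1 B2)); rewrite abse_EFin.
Qed.

Lemma pairing_error_sqr (Q I : rect R d1 d2) :
  pairing_error T Q I ^+ 2 = rvol I * (side I.2 / side Q.2) `^ alpha2 T.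
Proof.
have r0 : 0 < side I.2 / side Q.2 by rewrite divr_gt0// side_gt0.
rewrite exprMn sqr_sqrtr; last by rewrite mulr_ge0// ltW// vol_gt0.
by rewrite expr2 -powRD ?(gt_eqF r0) ?implybT// -splitr.
Qed.

End pairing_bound.

(** * Summation over the cubes of the grid *)

Section scales.
Context (R : realType) (d1 d2 : nat).
Local Notation Rd := (Rn R d1 * Rn R d2)%type.
Implicit Types Q I J : rect R d1 d2.

Lemma measurable_rset Q : measurable (rset Q).
Proof. by apply: measurableX; exact: measurable_cset. Qed.

Lemma leb2_rset Q : leb2 R d1 d2 (rset Q) = (rvol Q)%:E.
Proof.
rewrite /leb2 product_measure1E; [|exact: measurable_cset|exact: measurable_cset].
by rewrite [X in (X * _)%E]leb_cset [X in (_ * X)%E]leb_cset.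
Qed.

Lemma rset_sub Q I : rset I `<=` rset Q ->
  cset I.1 `<=` cset Q.1 /\ cset I.2 `<=` cset Q.2.
Proof.
move=> IQ; split=> x Ix.
  by have [] := IQ (x, I.2.1) (conj Ix (cset_corner _)).
by have [] := IQ (I.1.1, x) (conj (cset_corner _) Ix).
Qed.

(** Disjoint subsets of Q: the indicators add up to at most that of Q. *)
Lemma sum_disjoint_rvol_le (s : seq (rect R d1 d2)) Q :
  uniq s -> (forall I, I \in s -> rset I `<=` rset Q) ->
  (forall I J x, I \in s -> J \in s -> rset I x -> rset J x -> I = J) ->
  \sum_(I <- s) rvol I <= rvol Q.
Proof.
move=> us sQ disj; rewrite -lee_fin -leb2_rset -sumEFin.
have indE I : (rvol I)%:E = (\int[leb2 R d1 d2]_x (\1_(rset I) x)%:E)%E.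
  by rewrite -leb2_rset integral_indic ?setIT//; exact: measurable_rset.
have -> : leb2 R d1 d2 (rset Q) = (\int[leb2 R d1 d2]_x (\1_(rset Q) x)%:E)%E.
  by rewrite integral_indic ?setIT//; exact: measurable_rset.
under eq_bigr do rewrite indE.
rewrite -ge0_integral_sum//; last first.
  by move=> I; apply/measurable_EFinP; apply: measurable_indic; exact: measurable_rset.
apply: le_integral_ge0 => x; first by apply: sume_ge0 => I _; rewrite lee_fin.
rewrite sumEFin lee_fin.
have [/hasP[I Is /asboolP Ix]|/hasPn none] := boolP (has (fun I => `[< rset I x >]) s).
  rewrite (bigD1_seq I)//= big_seq_cond big1 => [|J /andP[Js JI]].
    by rewrite addr0 !indicE !mem_set//; exact: sQ Ix.
  rewrite indicE memNset// => Jx; move/negP: JI; apply; apply/eqP.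
  exact: (disj _ _ x).
rewrite big_seq big1// => I /none /asboolPn Ix.
by rewrite indicE memNset.
Qed.

Variables (D1 : set (cube R d1)) (D2 : set (cube R d2)).
Hypotheses (hD1 : dyadic_grid D1) (hD2 : dyadic_grid D2) (d20 : (0 < d2)%N).

(** Sides are integer powers of 2, so their ratio is a power of 1/2. *)
Lemma dyadic_scale Q I : diag_grid D1 D2 Q -> diag_grid D1 D2 I ->
  rset I `<=` rset Q -> exists k : nat, side I.2 / side Q.2 = (2 ^+ k)^-1.
Proof.
move=> [_ DQ _] [_ DI _] /rset_sub[_ IQ].
have sIQ := cset_sub_side d20 IQ.
have [pow _ _] := hD2; have [i Ii] := pow _ DI; have [q Qq] := pow _ DQ.
have iq : (i <= q)%R by move: sIQ; rewrite Ii Qq ler_eXz2l// ltr1n.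
have qE : q = i + `|q - i|%N by rewrite gez0_abs ?subr_ge0// addrCA subrr addr0.
exists `|q - i|%N; rewrite Ii Qq [X in _ / 2 ^ X]qE expfzDr ?pnatr_eq0//.
by rewrite invfM mulrA mulfV ?mul1r// expfz_neq0// pnatr_eq0.
Qed.

(** At each scale the cubes are disjoint, so those of side 2^{-k} side Q contribute
    at most 2^{-ka} |Q|. *)
Lemma sum_scales_le (s : seq (rect R d1 d2)) Q (a : R) :
  0 < a -> uniq s -> diag_grid D1 D2 Q ->
  (forall I, I \in s -> diag_grid D1 D2 I /\ rset I `<=` rset Q) ->
  \sum_(I <- s) rvol I * (side I.2 / side Q.2) `^ a <= rvol Q / (1 - 2 `^ (- a)).
Proof.
move=> a0 us DQ sP.
have /choice[kI kP] : forall I, exists k, I \in s -> side I.2 / side Q.2 = (2 ^+ k)^-1.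
  move=> I; have [/sP[DI IQ]|Is] := boolP (I \in s); last by exists 0%N.
  by have [k kE] := dyadic_scale DQ DI IQ; exists k.
(* Any bound on the finitely many scales present in s will do. *)
pose N := (\sum_(I <- s) kI I).+1.
have kN I : I \in s -> (kI I < N)%N.
  by move=> Is; rewrite ltnS (bigD1_seq I)//= leq_addr.
pose q : R := 2 `^ (- a).
have term I : I \in s -> rvol I * (side I.2 / side Q.2) `^ a = q ^+ kI I * rvol I.
  move=> Is; rewrite kP// mulrC; congr (_ * _).
  by rewrite -powR_inv1 ?exprn_ge0// -powRrM mulN1r powR_exprn.
rewrite big_seq (eq_bigr _ term) -big_seq.
have -> : \sum_(I <- s) q ^+ kI I * rvol I =
    \sum_(k < N) \sum_(I <- s | kI I == k) q ^+ k * rvol I.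
  rewrite (exchange_big_dep predT)//=; apply: eq_big_seq => I Is.
  by rewrite (big_pred1 (Ordinal (kN _ Is))).
apply: (@le_trans _ _ (\sum_(k < N) q ^+ k * rvol Q)).
  apply: ler_sum => k _; rewrite -mulr_sumr; apply: ler_wpM2l.
    by rewrite exprn_ge0// powR_ge0.
  rewrite -big_filter; apply: sum_disjoint_rvol_le.
  - exact: filter_uniq.
  - by move=> I; rewrite mem_filter => /andP[_ /sP[]].
  - move=> I J x; rewrite !mem_filter => /andP[/eqP kIk Is] /andP[/eqP kJk Js].
    move=> [I1x I2x] [J1x J2x].
    have [[DI1 DI2 cI] _] := sP _ Is; have [[DJ1 DJ2 cJ] _] := sP _ Js.
    have s2 : side I.2 = side J.2.
      have Q0 := side_gt0 Q.2.
      have : side I.2 / side Q.2 = side J.2 / side Q.2 by rewrite !kP// kIk kJk.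
      by move=> /(mulIf _); apply; rewrite invr_neq0// gt_eqF.
    have s1 : side I.1 = side J.1 by rewrite cI cJ.
    rewrite [I]surjective_pairing [J]surjective_pairing.
    by rewrite (dyadic_eq hD1 DI1 DJ1 s1 I1x J1x) (dyadic_eq hD2 DI2 DJ2 s2 I2x J2x).
rewrite -mulr_suml mulrC; apply: ler_wpM2l.
  by rewrite mulr_ge0// ltW// vol_gt0.
exact/sum_geometric_le/powR_half_lt1.
Qed.

End scales.

Section square_sum.
Context (R : realType) (d1 d2 : nat) (T : flagSIO R d1 d2).
Variables (D1 : set (cube R d1)) (D2 : set (cube R d2)).
Hypotheses (d10 : (0 < d1)%N) (d20 : (0 < d2)%N).
Hypotheses (hD1 : dyadic_grid D1) (hD2 : dyadic_grid D2).
Local Notation Rd := (Rn R d1 * Rn R d2)%type.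
Local Notation eta_type := {ffun 'I_d2 -> bool}.

Lemma sqre_le (x : \bar R) (f e : R) : (`|x| <= (`|f| + e)%:E)%E ->
  (`|x| ^+ 2 <= (2 * f ^+ 2 + 2 * e ^+ 2)%:E)%E.
Proof.
move=> xfe; apply: (@le_trans _ _ (((`|f| + e) * (`|f| + e))%:E)).
  by rewrite expe2 EFinM; apply: lee_pmul.
rewrite lee_fin -(real_normK (num_real f)).
have := sqr_ge0 (`|f| - e); rewrite sqrrB; lra.
Qed.

Definition cancellative_card : nat := #|[pred eta : eta_type | eta != eta0]|.

(** The part of the sum coming from the forms is handled by Bessel's inequality on
    3Q, the errors by the sum over scales; each cube carries finitely many
    signatures. *)
Lemma square_sum_le (C : R) (phi : Rd -> R) (Q : rect R d1 d2) (s : seq (rect R d1 d2)) :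
  diag_grid D1 D2 Q ->
  measurable_fun [set: Rd] phi ->
  (\int[leb2 R d1 d2]_x (phi x ^+ 2)%:E <= (C * rvol Q)%:E)%E ->
  (forall g, dom T g -> (forall x, ~ rset (triple_rect Q) x -> g x = 0) ->
    (form T (rind (triple_rect Q)) g)%:E = (\int[leb2 R d1 d2]_x (phi x * g x)%:E)%E) ->
  uniq s -> (forall I, I \in s -> diag_grid D1 D2 I /\ rset I `<=` rset Q) ->
  (\sum_(I <- s) \sum_(eta : eta_type | eta != eta0) `|T1_pairing T Q I eta| ^+ 2
    <= ((2 * C + 2 * pairing_const T ^+ 2 * cancellative_card%:R
          / (1 - 2 `^ (- alpha2 T))) * rvol Q)%:E)%E.
Proof.
move=> DQ mphi phiC test us sP.
have cQ : is_cube Q by case: DQ.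
pose f I eta := form T (rind (triple_rect Q)) (rect_haar (I, eta)).
pose e I := pairing_const T * pairing_error T Q I.
apply: (@le_trans _ _ (\sum_(I <- s) \sum_(eta : eta_type | eta != eta0)
    (2 * f I eta ^+ 2 + 2 * e I ^+ 2)%:E)%E).
  rewrite big_seq [leRHS]big_seq; apply: lee_sum => I Is; apply: lee_sum => eta eta_neq0.
  have [DI /rset_sub[IQ1 IQ2]] := sP _ Is; have cI : is_cube I by case: DI.
  by apply: sqre_le; exact: T1_pairing_bound.
under eq_bigr do rewrite sumEFin.
rewrite sumEFin lee_fin.
under eq_bigr do rewrite big_split/= sumr_const -mulr_sumr.
rewrite big_split/= -mulr_sumr [leRHS]mulrDl; apply: lerD.
  rewrite -mulrA; apply: ler_wpM2l => //.
  pose ps : seq (rect R d1 d2 * eta_type) :=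
    [seq (J, eta) | J <- s, eta <- enum [pred eta : eta_type | eta != eta0]].
  have bessel := @bessel_form R d1 d2 T D1 D2 (triple_rect Q) phi (C * rvol Q) ps
    d20 hD1 hD2 mphi phiC test.
  rewrite /ps big_allpairs in bessel.
  rewrite (eq_bigr (fun I => \sum_(eta <- enum [pred eta : eta_type | eta != eta0])
    f I eta ^+ 2)) => [|I _]; last by rewrite big_enum.
  apply: bessel.
    by apply: allpairs_uniq => //; [exact: enum_uniq|move=> [? ?] [? ?]].
  move=> p /allpairsP[[I eta] /= [Is]]; rewrite mem_enum inE => eta_neq0 ->.
  have [DI IQ] := sP _ Is; split=> //.
  move=> x /IQ [Qx1 Qx2]; split; exact: triple_sup.
have cst : forall I, (2 * e I ^+ 2) *+ cancellative_card =
    2 * pairing_const T ^+ 2 * cancellative_card%:R *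
      (rvol I * (side I.2 / side Q.2) `^ alpha2 T).
  by move=> I; rewrite -pairing_error_sqr /e exprMn -mulr_natr; ring.
rewrite (eq_bigr _ (fun I _ => cst I)) -mulr_sumr -[leRHS]mulrA.
apply: ler_wpM2l; first by rewrite mulr_ge0// mulr_ge0// sqr_ge0.
have /andP[al0 _] := alpha2_itv T.
rewrite [leRHS]mulrC; exact: (sum_scales_le hD1 hD2 d20 al0 us DQ sP).
Qed.

End square_sum.

Theorem theorem3 (R : realType) (d1 d2 : nat) (hd1 : (0 < d1)%N) (hd2 : (0 < d2)%N)
    (D1 : set (cube R d1)) (D2 : set (cube R d2))
    (hD1 : dyadic_grid D1) (hD2 : dyadic_grid D2)
    (T : flagSIO R d1 d2) (hT : cube_testing T) :
  (ereal_sup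
     [set (Num.sqrt (rvol Q))^-1%:E *
          (\esum_(I in diag_grid D1 D2 `&` [set I | rset I `<=` rset Q])
             \sum_(eta : {ffun 'I_d2 -> bool} | eta != eta0)
                `|T1_pairing T Q I eta| ^+ 2) `^ 2^-1
     | Q in diag_grid D1 D2] < +oo)%E.
Proof.
have [C CT] := hT.
pose B := 2 * (C ^+ 2 * (3 ^+ d1 * 3 ^+ d2)) + 2 * pairing_const T ^+ 2 *
  (cancellative_card d2)%:R / (1 - 2 `^ (- alpha2 T)).
apply: (@le_lt_trans _ _ (B `^ 2^-1)%:E); last exact: ltry.
apply: ge_ereal_sup => _ [Q DQ <-].
have v0 : 0 < rvol Q by rewrite mulr_gt0// vol_gt0.
have cQ3 : is_cube (triple_rect Q).
  by case: DQ => _ _; rewrite /is_cube /= !side_triple => ->.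
have [phi [mphi _ test phiC]] := CT _ cQ3.
have phi2 : (\int[leb2 R d1 d2]_x (phi x ^+ 2)%:E <=
    (C ^+ 2 * (3 ^+ d1 * 3 ^+ d2) * rvol Q)%:E)%E.
  apply: le_trans (Lnorm2_sqr phiC) _; rewrite lee_fin exprMn sqr_sqrtr.
    by rewrite /rvol !vol_triple le_eqVlt; apply/orP; left; apply/eqP; ring.
  by rewrite mulr_ge0// ltW// vol_gt0.
have le_B : (\esum_(I in diag_grid D1 D2 `&` [set I | rset I `<=` rset Q])
             \sum_(eta : {ffun 'I_d2 -> bool} | eta != eta0)
                `|T1_pairing T Q I eta| ^+ 2 <= (B * rvol Q)%:E)%E.
  apply: ge_ereal_sup => _ [A [finA AS] <-].
  rewrite fsbig_finite//=; apply: (square_sum_le hd1 hd2 hD1 hD2 DQ mphi phi2 test).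
    exact: finmap.fset_uniq.
  by move=> I; rewrite in_fset_set// => /set_mem/AS[].
have sum0 : (0 <= \esum_(I in diag_grid D1 D2 `&` [set I | rset I `<=` rset Q])
             \sum_(eta : {ffun 'I_d2 -> bool} | eta != eta0)
                `|T1_pairing T Q I eta| ^+ 2)%E.
  by apply: esum_ge0 => I _; apply: sume_ge0 => eta _; exact: expe_ge0.
have Bv0 : 0 <= B * rvol Q by rewrite -lee_fin (le_trans sum0).
have B0 : 0 <= B by rewrite -(pmulr_lge0 B v0).
apply: (@le_trans _ _ ((Num.sqrt (rvol Q))^-1%:E * (B * rvol Q)%:E `^ 2^-1)%E).
  apply: lee_wpmul2l; first by rewrite lee_fin invr_ge0 sqrtr_ge0.
  by apply: gt0_ler_poweR => //; rewrite in_itv/= ?sum0 ?lee_fin ?Bv0 leey.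
rewrite poweR_EFin -EFinM lee_fin powRM ?(ltW v0)// (powR12_sqrt (ltW v0)).
by rewrite mulrC -mulrA divff ?mulr1// gt_eqF// sqrtr_gt0.
Qed.
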